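(* Let $p\ge 3$ and let $\varepsilon_1=(1,0,\dots,0)'\in\mathbb{R}^{p-1}$. Let $\Gamma_{11},U_1,U_2,\Delta$ be independent random objects such that: $\Gamma_{11}$ is a real random variable with density $$f(x\mid p)=\frac{\Gamma(\frac12 p)}{\Gamma(\frac12)\,\Gamma(\frac12(p-1))}\,(1-x^2)^{(p-3)/2},\qquad |x|<1$$ (here $\Gamma(\cdot)$ in the formula is the gamma function); $U_1$ and $U_2$ are uniformly distributed on the unit sphere $\mathcal{S}_{p-1}=\{x\in\mathbb{R}^{p-1}:\|x\|=1\}$; and $\Delta$ has the Haar distribution on the group $\mathcal{O}_{p-2}$ of $(p-2)\times(p-2)$ real orthogonal matrices. Set $$\Gamma_{21}=\sqrt{1-\Gamma_{11}^2}\,U_1,\qquad \Gamma_{12}=\sqrt{1-\Gamma_{11}^2}\,U_2',$$ and let $h_1=H\!\left(\sqrt{1-\Gamma_{11}^2}\,\varepsilon_1,\Gamma_{21}\right)$ and $h_2=H\!\left(\sqrt{1-\Gamma_{11}^2}\,\varepsilon_1,\Gamma_{12}'\right)$, where $H(u,v)$ is the orthogonal matrix defined in the context (so that $h_1\sqrt{1-\Gamma_{11}^2}\,\varepsilon_1=\Gamma_{21}$ and $h_2\sqrt{1-\Gamma_{11}^2}\,\varepsilon_1=\Gamma_{12}'$). Then the random matrix $$\Gamma=\begin{pmatrix}\Gamma_{11}&\Gamma_{12}\\ \Gamma_{21}&h_1\Gamma_{22}^*h_2'\end{pmatrix},\qquad \Gamma_{22}^*=\begin{pmatrix}-\Gamma_{11}&0\\0&\Delta\end{pmatrix},$$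 is Haar distributed on the group $\mathcal{O}_p$ of $p\times p$ real orthogonal matrices.
   Context: A prime denotes transpose. For vectors $u,v\in\mathbb{R}^{p-1}$ with $\|u\|=\|v\|>0$, define the $(p-1)\times(p-1)$ matrix $$H(u,v)=\begin{cases}I_{p-1}-2\dfrac{ww'}{w'w},\ \ w=u-v,&\text{if }u\ne v,\\ I_{p-1}&\text{if }u=v.\end{cases}$$ The Haar distribution on $\mathcal{O}_n$ is the unique probability distribution invariant under left and right multiplication by elements of $\mathcal{O}_n$. The uniform distribution on $\mathcal{S}_{p-1}$ is the unique probability distribution on it invariant under $\mathcal{O}_{p-1}$. *)

(* Defs.v *)
From HB Require Import structures.
From mathcomp Require Import all_boot all_order all_algebra.
From mathcomp Require Import all_classical all_reals all_analysis.

Set Implicit Arguments.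
Unset Strict Implicit.
Unset Printing Implicit Defensive.

Import Order.TTheory GRing.Theory Num.Theory.
Import numFieldNormedType.Exports.

Local Open Scope classical_set_scope.
Local Open Scope ring_scope.

HB.instance Definition _ (R : realType) (m n : nat) :=
  Measurable.copy 'M[R]_(m, n) (g_sigma_algebraType (@open 'M[R]_(m, n))).

(* The norm that the library puts on matrices is the sup norm, hence this
   definition of the Euclidean norm. *)
Definition enorm (R : realType) (n : nat) (x : 'cV[R]_n) : R :=
  Num.sqrt (\sum_i x i 0 ^+ 2).

Definition unit_sphere (R : realType) (n : nat) : set 'cV[R]_n :=
  [set x | enorm x = 1].

Definition orthogonal_group (R : realType) (n : nat) : set 'M[R]_n :=
  [set Q | Q^T *m Q = 1%:M].

(* Distributions on O_n (resp. on the sphere) are represented as Borel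
   probabilities on the ambient space 'M_n (resp. 'cV_n) that give O_n (resp.
   the sphere) probability 1. *)
Definition haar_distribution (R : realType) (n : nat)
    (mu : probability 'M[R]_n R) : Prop :=
  mu (@orthogonal_group R n) = 1%E /\
  forall Q : 'M[R]_n, orthogonal_group Q ->
  forall B : set 'M[R]_n, measurable B ->
    mu ((fun A => Q *m A) @^-1` B) = mu B /\
    mu ((fun A => A *m Q) @^-1` B) = mu B.

Definition uniform_sphere (R : realType) (n : nat)
    (mu : probability 'cV[R]_n R) : Prop :=
  mu (@unit_sphere R n) = 1%E /\
  forall Q : 'M[R]_n, orthogonal_group Q ->
  forall B : set 'cV[R]_n, measurable B ->
    mu ((fun x => Q *m x) @^-1` B) = mu B.

Definition independent_classes d (T : measurableType d) (R : realType)
    (P : probability T R) (I : finType) (F : I -> set (set T)) : Prop :=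
  forall (J : {set I}) (E : I -> set T),
    (forall i, i \in J -> F i (E i)) ->
    P (\bigcap_(i in [set` J]) E i) = (\prod_(i in J) P (E i))%E.

(* The sigma-algebra generated by a random element; four random elements with
   values in different spaces are independent when the sigma-algebras that
   they generate are. *)
Definition sigma_of d d' (T : measurableType d) (T' : measurableType d')
    (X : T -> T') : set (set T) :=
  preimage_set_system setT X measurable.

Definition independent4 d (T : measurableType d) (R : realType)
    (P : probability T R) d1 (T1 : measurableType d1) d2
    (T2 : measurableType d2) d3 (T3 : measurableType d3) d4
    (T4 : measurableType d4) (X1 : T -> T1) (X2 : T -> T2) (X3 : T -> T3)
    (X4 : T -> T4) : Prop :=
  independent_classes P
    (tnth [tuple sigma_of X1; sigma_of X2; sigma_of X3; sigma_of X4]).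

Definition has_density (R : realType) (mu : probability R R) (f : R -> R) :
    Prop :=
  forall B : set R, measurable B ->
    mu B = (\int[lebesgue_measure]_(x in B) (f x)%:E)%E.

Definition gamma_function (R : realType) (a : R) : R :=
  (\int[lebesgue_measure]_(t in `]0, +oo[) (t `^ (a - 1) * expR (- t)))%R.

Definition corner_density (R : realType) (p : nat) (x : R) : R :=
  if `|x| < 1 then
    gamma_function (2^-1 * p%:R) /
      (gamma_function 2^-1 * gamma_function (2^-1 * (p%:R - 1))) *
    (1 - x ^+ 2) `^ ((p%:R - 3) / 2)
  else 0.

Definition householder (R : realType) (n : nat) (u v : 'cV[R]_n) : 'M[R]_n :=
  let w := u - v in
  if u == v then 1%:M
  else 1%:M - (2 / (w^T *m w) 0 0) *: (w *m w^T).

(* The matrix Gamma for p = n + 3, built from the values of Gamma_11, U_1, U_2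
   and Delta. *)
Definition Gamma (R : realType) (n : nat) (g11 : R) (u1 u2 : 'cV[R]_n.+2)
    (delta : 'M[R]_n.+1) : 'M[R]_n.+3 :=
  let s := Num.sqrt (1 - g11 ^+ 2) in
  let eps1 : 'cV[R]_n.+2 := delta_mx 0 0 in
  let g21 := s *: u1 in
  let g12 := s *: u2^T in
  let h1 := householder (s *: eps1) g21 in
  let h2 := householder (s *: eps1) g12^T in
  let g22s : 'M[R]_(1 + n.+1) := block_mx (- g11)%:M 0 0 delta in
  block_mx (g11%:M : 'M[R]_1) g12 g21 (h1 *m g22s *m h2^T).

(* Main.v *)
From HB Require Import structures.
Require Import Defs.
From mathcomp Require Import all_boot all_order all_algebra.
From mathcomp Require Import all_classical all_reals all_analysis.
From mathcomp Require Import measurable_realfun ring lra.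

(** Write m = p - 1, let e1 be the first basis vector, and let stab(A) be the
block matrix with blocks 1 and A, which ranges over the stabilizer of e1 when
A ranges over the orthogonal group.  Almost surely

      Gamma = M(Gamma_11, U_1) * stab(Psi),   Psi = stab(Delta) * H(e1, U_2)',

where M(g, u) is orthogonal with first column x = (g, sqrt (1 - g^2) u)
([Gamma_factor], [orthogonal_corner_mx]).  The two factors are independent, so
everything follows from one principle, [left_invariant_extension]: if the first
column of a random orthogonal M is uniform on the sphere and Psi is Haar and
independent of M, then M * stab(Psi) is Haar.  Indeed, two orthogonal matrices
with the same first column differ by a right factor stab(q), and q is absorbed
by the Haar matrix Psi; so the conditional law of M * stab(Psi) depends only on
the first column, whose law is invariant.  This gives left invariance, and left
invariance suffices: averaging 1_B(a' b) over two independent copies a, b of a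
left-invariant law mu shows that mu is invariant under transposition
([left_invariant_haar]).

The principle is applied twice: to the transpose H(e1, U_2) * stab(Delta') of
Psi, whose first column U_2 is uniform by hypothesis, and to Gamma itself,
where one has to know that the first column x is uniform on the unit sphere of
R^p.  This is where the density of Gamma_11 enters.  Lebesgue measure on R^p is
invariant under the orthogonal group, because it is invariant under translation
and a translation-invariant measure is unique up to a constant
([translation_invariant_swap], [lebesgue_orthogonal]).  Hence the measure of
the part of the unit ball that lies over a set A of directions is an invariant
function of A.  On R x R^m, this measure is computed by replacing the direction
of the R^m component by a uniform one ([cone_slice]), by using that the squared
norm on R^m has a law proportional to t^((m-2)/2) dt ([sqnorm_law]), and by
passing to polar coordinates ([polar_coordinates]).  The result is a constant
times the integral over g of (1 - g^2)^((m-2)/2) P((g, sqrt (1 - g^2) U) in A)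
([cone_measure]), that is, a constant times P(x in A).  All constants are
cancelled without being computed. *)

Set Implicit Arguments.
Unset Strict Implicit.
Unset Printing Implicit Defensive.

Import Order.TTheory GRing.Theory Num.Theory.
Import numFieldNormedType.Exports.

Local Open Scope classical_set_scope.
Local Open Scope ring_scope.

(** * Measurability of matrix-valued maps *)

Lemma open_measurable_mx (R : realType) m n (A : set 'M[R]_(m, n)) :
  open A -> measurable A.
Proof. by move=> oA; exact: sub_sigma_algebra. Qed.

Lemma measurable_entry (R : realType) m n (i : 'I_m) (j : 'I_n) :
  measurable_fun setT (fun M : 'M[R]_(m, n) => M i j).
Proof.
apply: (measurability _ (RGenOpens.measurableE R)).
move=> _ [_ [a [b ->]] <-]; rewrite setTI; apply: open_measurable_mx.
apply: open_comp; last exact: interval_open.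
by move=> ? _; exact: coord_continuous.
Qed.

(** An open set of matrices is a countable union of sup-norm balls with rational
centers and radii 1/(k+1), and such a ball is a finite intersection of
conditions on single entries. *)
Lemma measurable_mx d (T : measurableType d) (R : realType) m n
    (f : T -> 'M[R]_(m, n)) :
  (forall i j, measurable_fun setT (fun t => f t i j)) -> measurable_fun setT f.
Proof.
move=> mf.
have mE : @measurable _ 'M[R]_(m, n) = <<s @open 'M[R]_(m, n) >> by [].
apply: (measurability _ mE) => _ [V oV <-]; rewrite setTI.
pose D (q : 'M[rat]_(m, n) * nat) : set 'M[R]_(m, n) :=
  [set M : 'M[R]_(m, n) | forall i j, ball (ratr (q.1 i j) : R) (q.2.+1%:R^-1) (M i j)].
have -> : V = \bigcup_(q in [set q | D q `<=` V]) D q.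
  apply/seteqP; split=> [M VM|M [q qV]]; last exact: qV.
  have /nbhs_ballP[e /= e0 eV] : nbhs M V by exact: open_nbhs_nbhs.
  (* the radius 1/(k+1) is less than e/2 *)
  pose k := Num.truncn (2 / e).
  have ke : k.+1%:R^-1 *+ 2 < e.
    have : 2 / e < k.+1%:R by exact: Num.Theory.truncnS_gt.
    rewrite -[X in _ -> X < _]mulr_natl (ltr_pdivrMr _ _ e0).
    by rewrite (ltr_pdivrMr _ _ (ltr0Sn _ k)) mulrC.
  have qP i j : exists q : rat, ball (M i j) (k.+1%:R^-1) (ratr q : R).
    have : M i j - k.+1%:R^-1 < M i j + k.+1%:R^-1.
      by rewrite ltrD2l; apply: (@lt_trans _ _ 0); rewrite ?oppr_lt0 ?invr_gt0.
    case/rat_in_itvoo => q; rewrite in_itv/= => /andP[q1 q2]; exists q.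
    by rewrite /ball/= ltr_distlC q1 q2.
  pose q := \matrix_(i, j) xget (0 : rat) [set x : rat | ball (M i j) (k.+1%:R^-1) (ratr x : R)].
  have qP' i j : ball (M i j) (k.+1%:R^-1) (ratr (q i j) : R).
    rewrite mxE; exact: (@xgetPex _ (0 : rat) [set x : rat | ball (M i j) (k.+1%:R^-1) (ratr x : R)] (qP i j)).
  exists (q, k) => /=; last by move=> i j /=; exact/ball_sym.
  move=> N DN; apply: eV; split=> // i j.
  have := ball_triangle (qP' i j) (DN i j).
  by apply: le_ball; rewrite -mulr2n ltW.
rewrite preimage_bigcup bigcup_mkcond.
apply: countable_bigcupT_measurable => [|q]; first exact: countableP.
case: ifPn => // _.
have -> : f @^-1` D q = \bigcap_(ij in [set: 'I_m * 'I_n])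
    ((fun t => f t ij.1 ij.2) @^-1` ball (ratr (q.1 ij.1 ij.2) : R) (q.2.+1%:R^-1)).
  apply/seteqP; split=> [t Dt [i j] _|t Dt i j]; first exact: Dt.
  exact: (Dt (i, j)).
apply: fin_bigcap_measurable => // ij _.
by rewrite -[X in measurable X]setTI; apply: mf => //; exact: measurable_ball.
Qed.

Lemma measurable_sqrtr (R : realType) : measurable_fun setT (@Num.sqrt R).
Proof. by apply: continuous_measurable_fun; exact: sqrt_continuous. Qed.

Lemma measurable_invr (R : realType) : measurable_fun setT (@GRing.inv R).
Proof.
have -> : @GRing.inv R = (fun x => x * (x ^+ 2) `^ (-1)).
  apply/funext => x; rewrite powR_inv1 ?sqr_ge0//.
  have [->|x0] := eqVneq x 0; first by rewrite invr0 mul0r.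
  by rewrite expr2 invfM mulrA divff// mul1r.
apply: measurable_funM => //.
apply: (measurableT_comp (@measurable_powR R (-1))); exact: exprn_measurable.
Qed.

Section measurable_matrix_operations.
Context d (T : measurableType d) (R : realType).

Lemma measurable_entry_comp m n (f : T -> 'M[R]_(m, n)) i j :
  measurable_fun setT f -> measurable_fun setT (fun t => f t i j).
Proof. by move=> mf; exact: (measurableT_comp (measurable_entry i j)). Qed.

Lemma measurable_mulmx m n p (f : T -> 'M[R]_(m, n)) (g : T -> 'M[R]_(n, p)) :
  measurable_fun setT f -> measurable_fun setT g ->
  measurable_fun setT (fun t => f t *m g t).
Proof.
move=> mf mg; apply: measurable_mx => i j.
under eq_fun do rewrite mxE.
by apply: measurable_sum => k; apply: measurable_funM; exact: measurable_entry_comp.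
Qed.

Lemma measurable_trmx m n (f : T -> 'M[R]_(m, n)) :
  measurable_fun setT f -> measurable_fun setT (fun t => (f t)^T).
Proof.
move=> mf; apply: measurable_mx => i j; under eq_fun do rewrite mxE.
exact: measurable_entry_comp.
Qed.

Lemma measurable_addmx m n (f g : T -> 'M[R]_(m, n)) :
  measurable_fun setT f -> measurable_fun setT g ->
  measurable_fun setT (fun t => f t + g t).
Proof.
move=> mf mg; apply: measurable_mx => i j; under eq_fun do rewrite mxE.
by apply: measurable_funD; exact: measurable_entry_comp.
Qed.

Lemma measurable_scalemx m n (c : T -> R) (f : T -> 'M[R]_(m, n)) :
  measurable_fun setT c -> measurable_fun setT f ->
  measurable_fun setT (fun t => c t *: f t).
Proof.
move=> mc mf; apply: measurable_mx => i j; under eq_fun do rewrite mxE.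
by apply: measurable_funM => //; exact: measurable_entry_comp.
Qed.

Lemma measurable_submx m n (f g : T -> 'M[R]_(m, n)) :
  measurable_fun setT f -> measurable_fun setT g ->
  measurable_fun setT (fun t => f t - g t).
Proof.
move=> mf mg; under eq_fun do rewrite -scaleN1r.
by apply: measurable_addmx => //; exact: measurable_scalemx.
Qed.

Lemma measurable_scalar_mx n (c : T -> R) : measurable_fun setT c ->
  measurable_fun setT (fun t => (c t)%:M : 'M[R]_n).
Proof.
move=> mc; under eq_fun do rewrite -scalemx1.
exact: measurable_scalemx.
Qed.

Lemma measurable_block_mx m1 m2 n1 n2 (a : T -> 'M[R]_(m1, n1))
    (b : T -> 'M[R]_(m1, n2)) (c : T -> 'M[R]_(m2, n1))
    (e : T -> 'M[R]_(m2, n2)) :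
  measurable_fun setT a -> measurable_fun setT b -> measurable_fun setT c ->
  measurable_fun setT e ->
  measurable_fun setT (fun t => block_mx (a t) (b t) (c t) (e t)).
Proof.
move=> ma mb mc me; apply: measurable_mx => i j.
case: (split_ordP i) => i' ->; case: (split_ordP j) => j' ->.
- under eq_fun do rewrite block_mxEul; exact: measurable_entry_comp.
- under eq_fun do rewrite block_mxEur; exact: measurable_entry_comp.
- under eq_fun do rewrite block_mxEdl; exact: measurable_entry_comp.
- under eq_fun do rewrite block_mxEdr; exact: measurable_entry_comp.
Qed.

Lemma measurable_col_mx m1 m2 n (a : T -> 'M[R]_(m1, n)) (b : T -> 'M[R]_(m2, n)) :
  measurable_fun setT a -> measurable_fun setT b ->
  measurable_fun setT (fun t => col_mx (a t) (b t)).
Proof.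
move=> ma mb; apply: measurable_mx => i j; case: (split_ordP i) => i' ->.
- under eq_fun do rewrite col_mxEu; exact: measurable_entry_comp.
- under eq_fun do rewrite col_mxEd; exact: measurable_entry_comp.
Qed.

Lemma measurable_eq_mx m n (f g : T -> 'M[R]_(m, n)) :
  measurable_fun setT f -> measurable_fun setT g ->
  measurable_fun setT (fun t => f t == g t).
Proof.
move=> mf mg; apply: (measurable_fun_bool true); rewrite setTI.
have -> : (fun t => f t == g t) @^-1` [set true] =
    \bigcap_(ij in [set: 'I_m * 'I_n])
      ((fun t => f t ij.1 ij.2 - g t ij.1 ij.2) @^-1` [set 0]).
  apply/seteqP; split=> [t /= fg ij _ /=|t /= h].
    by have /eqP -> : f t == g t := fg; rewrite subrr.
  apply/eqP/matrixP => i j; apply/eqP; rewrite -subr_eq0; apply/eqP.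
  exact: (h (i, j)).
apply: fin_bigcap_measurable => // ij _; rewrite -[X in measurable X]setTI.
have : measurable_fun setT (fun t => f t ij.1 ij.2 - g t ij.1 ij.2).
  by apply: measurable_funB; exact: measurable_entry_comp.
by apply => //; exact: measurable_set1.
Qed.

Lemma measurable_householder n (u v : T -> 'cV[R]_n) :
  measurable_fun setT u -> measurable_fun setT v ->
  measurable_fun setT (fun t => householder (u t) (v t)).
Proof.
move=> mu mv; rewrite /householder.
apply: measurable_fun_ifT.
- exact: measurable_eq_mx.
- exact: measurable_cst.
- have mw : measurable_fun setT (fun t => u t - v t) by exact: measurable_submx.
  have mwT := measurable_trmx mw.
  apply: measurable_submx; first exact: measurable_cst.
  apply: measurable_scalemx; last exact: measurable_mulmx.
  apply: measurable_funM => //; apply: measurableT_comp => //.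
    exact: measurable_invr.
  by apply: measurable_entry_comp; exact: measurable_mulmx.
Qed.

Lemma measurable_Gamma n (g11 : T -> R) (u1 u2 : T -> 'cV[R]_n.+2)
    (delta : T -> 'M[R]_n.+1) :
  measurable_fun setT g11 -> measurable_fun setT u1 -> measurable_fun setT u2 ->
  measurable_fun setT delta ->
  measurable_fun setT (fun t => Gamma (g11 t) (u1 t) (u2 t) (delta t)).
Proof.
move=> mg mu1 mu2 md.
have ms : measurable_fun setT (fun t => Num.sqrt (1 - g11 t ^+ 2)).
  apply: measurableT_comp; first exact: measurable_sqrtr.
  by apply: measurable_funB => //; exact: measurable_funX.
have m21 := measurable_scalemx ms mu1.
have m12 := measurable_scalemx ms (measurable_trmx mu2).
have me : measurable_fun setT
    (fun t => Num.sqrt (1 - g11 t ^+ 2) *: (delta_mx 0 0 : 'cV[R]_n.+2)).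
  by apply: measurable_scalemx => //; exact: measurable_cst.
apply: (@measurable_block_mx 1 n.+2 1 n.+2) => //.
  exact: measurable_scalar_mx.
apply: measurable_mulmx.
  apply: measurable_mulmx; first exact: measurable_householder.
  apply: (@measurable_block_mx 1 n.+1 1 n.+1) => //; try exact: measurable_cst.
  apply: measurable_scalar_mx; exact: measurable_funN.
apply/measurable_trmx/measurable_householder => //.
exact: measurable_trmx.
Qed.

End measurable_matrix_operations.

(** * Orthogonal matrices, stabilizers and reflections *)

Section orthogonal_matrices.
Variable R : realType.

(** The squared Euclidean norm, which unlike the norm is polynomial. *)
Definition sqnorm k (x : 'cV[R]_k) : R := (x^T *m x) 0 0.

Lemma sqnormE k (x : 'cV[R]_k) : sqnorm x = \sum_i x i 0 ^+ 2.
Proof. by rewrite /sqnorm mxE; apply: eq_bigr => i _; rewrite mxE expr2. Qed.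

Lemma sqnorm_ge0 k (x : 'cV[R]_k) : 0 <= sqnorm x.
Proof. by rewrite sqnormE sumr_ge0// => i _; rewrite sqr_ge0. Qed.

Lemma sqnorm_eq0 k (x : 'cV[R]_k) : (sqnorm x == 0) = (x == 0).
Proof.
rewrite sqnormE psumr_eq0; last by move=> i _; rewrite sqr_ge0.
apply/allP/eqP => [x0|-> i _]; last by rewrite mxE expr0n eqxx.
apply/colP => i; rewrite mxE; apply/eqP; rewrite -sqrf_eq0.
by apply: x0; rewrite mem_index_enum.
Qed.

Lemma sqnormZ k (c : R) (x : 'cV[R]_k) : sqnorm (c *: x) = c ^+ 2 * sqnorm x.
Proof. by rewrite !sqnormE mulr_sumr; apply: eq_bigr => i _; rewrite mxE exprMn. Qed.

Lemma sqnorm_mul_trmx k (x : 'cV[R]_k) : x^T *m x = (sqnorm x)%:M.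
Proof. exact: mx11_scalar. Qed.

Lemma sqnorm_col_mx k (x : R) (v : 'cV[R]_k) :
  sqnorm (col_mx x%:M v : 'cV[R]_(1 + k)) = x ^+ 2 + sqnorm v.
Proof.
by rewrite /sqnorm tr_col_mx mul_row_col tr_scalar_mx -scalar_mxM !mxE eqxx mulr1n expr2.
Qed.

Lemma unit_sphereP k (x : 'cV[R]_k) : unit_sphere x <-> sqnorm x = 1.
Proof.
rewrite /unit_sphere /= /enorm -sqnormE; split => [h|->]; last exact: sqrtr1.
by rewrite -[LHS]sqr_sqrtr ?sqnorm_ge0// h expr1n.
Qed.

Lemma sqnorm_delta k : sqnorm (delta_mx 0 0 : 'cV[R]_k.+1) = 1.
Proof. by rewrite /sqnorm trmx_delta mul_delta_mx mxE eqxx. Qed.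

Lemma orthogonal1 k : orthogonal_group (1%:M : 'M[R]_k).
Proof. by rewrite /orthogonal_group /= trmx1 mul1mx. Qed.

Lemma orthogonal_mulmxV k (Q : 'M[R]_k) : orthogonal_group Q -> Q *m Q^T = 1%:M.
Proof. exact: mulmx1C. Qed.

Lemma orthogonal_trmx k (Q : 'M[R]_k) : orthogonal_group Q -> orthogonal_group Q^T.
Proof. by move=> oQ; rewrite /orthogonal_group /= trmxK; exact: orthogonal_mulmxV. Qed.

Lemma orthogonal_mulmx k (P Q : 'M[R]_k) :
  orthogonal_group P -> orthogonal_group Q -> orthogonal_group (P *m Q).
Proof.
rewrite /orthogonal_group /= => oP oQ.
by rewrite trmx_mul mulmxA -(mulmxA Q^T) oP mulmx1.
Qed.

Lemma sqnorm_orthogonal k (Q : 'M[R]_k) (x : 'cV[R]_k) :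
  orthogonal_group Q -> sqnorm (Q *m x) = sqnorm x.
Proof. by move=> oQ; rewrite /sqnorm trmx_mul mulmxA -(mulmxA x^T) oQ mulmx1. Qed.

Definition stab_mx k (psi : 'M[R]_k) : 'M[R]_(1 + k) := block_mx 1%:M 0 0 psi.

Lemma stab_mxM k (a b : 'M[R]_k) : stab_mx (a *m b) = stab_mx a *m stab_mx b.
Proof.
by rewrite /stab_mx mulmx_block !mulmx0 !mul0mx !mul1mx !addr0 add0r.
Qed.

Lemma trmx_stab_mx k (a : 'M[R]_k) : (stab_mx a)^T = stab_mx a^T.
Proof. by rewrite /stab_mx tr_block_mx trmx1 !trmx0. Qed.

Lemma stab_mx1 k : stab_mx (1%:M : 'M[R]_k) = 1%:M.
Proof. by rewrite /stab_mx -scalar_mx_block. Qed.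

Lemma orthogonal_stab_mx k (psi : 'M[R]_k) :
  orthogonal_group psi -> orthogonal_group (stab_mx psi).
Proof.
by rewrite /orthogonal_group /= trmx_stab_mx -stab_mxM => ->; exact: stab_mx1.
Qed.

Lemma delta_mx_col k : (delta_mx 0 0 : 'cV[R]_(1 + k)) = col_mx 1%:M 0.
Proof.
apply/colP => i; rewrite !mxE; case: split_ordP => j ->.
  by rewrite !mxE !ord1.
by rewrite mxE.
Qed.

Lemma stab_mx_delta k (psi : 'M[R]_k) :
  stab_mx psi *m delta_mx 0 0 = delta_mx 0 0 :> 'cV[R]_(1 + k).
Proof.
by rewrite delta_mx_col /stab_mx mul_block_col !mulmx0 mul1mx mul0mx !addr0.
Qed.

(** The first column of Q is e1, and the first row of Q' Q = 1 then says that
the first row of Q vanishes after its first entry. *)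
Lemma orthogonal_fix_delta k (Q : 'M[R]_(1 + k)) : orthogonal_group Q ->
  Q *m delta_mx 0 0 = delta_mx 0 0 :> 'cV[R]_(1 + k) ->
  exists2 psi, orthogonal_group psi & Q = stab_mx psi.
Proof.
rewrite -[Q]submxK; move: (ulsubmx Q) (ursubmx Q) (dlsubmx Q) (drsubmx Q) => a b c e.
rewrite /orthogonal_group /= => oQ.
rewrite delta_mx_col mul_block_col !mulmx0 !mulmx1 !addr0.
move/eq_col_mx => [a1 c0]; move: oQ.
rewrite a1 c0 tr_block_mx trmx1 trmx0 mulmx_block.
rewrite !mul1mx !mulmx1 !mul0mx !mulmx0 !addr0.
rewrite [RHS](@scalar_mx_block _ 1 k) => /eq_block_mx[_ b0 _].
by rewrite b0 mulmx0 add0r => ee; exists e.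
Qed.

(** The orthogonal group acts with stabilizer stab(O_k) on the orbit of e1. *)
Lemma orthogonal_same_delta k (M N : 'M[R]_(1 + k)) :
  orthogonal_group M -> orthogonal_group N ->
  M *m delta_mx 0 0 = N *m delta_mx 0 0 :> 'cV[R]_(1 + k) ->
  exists2 psi, orthogonal_group psi & M = N *m stab_mx psi.
Proof.
move=> oM oN MN.
have [||psi opsi NM] := @orthogonal_fix_delta k (N^T *m M).
- by apply: orthogonal_mulmx => //; exact: orthogonal_trmx.
- by rewrite -mulmxA MN mulmxA oN mul1mx.
by exists psi => //; rewrite -NM mulmxA orthogonal_mulmxV// mul1mx.
Qed.

Lemma trmx_householder k (u v : 'cV[R]_k) : (householder u v)^T = householder u v.
Proof.
rewrite /householder; case: ifP => _; first exact: trmx1.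
by rewrite linearB/= trmx1 linearZ/= trmx_mul trmxK.
Qed.

Lemma orthogonal_householder k (u v : 'cV[R]_k) : orthogonal_group (householder u v).
Proof.
rewrite /orthogonal_group /= trmx_householder /householder.
case: eqVneq => [_|uv]; first by rewrite mulmx1.
set w := u - v; rewrite -/(sqnorm w).
have w0 : sqnorm w != 0 by rewrite sqnorm_eq0 subr_eq0.
set c := 2 / sqnorm w.
have wwww : (w *m w^T) *m (w *m w^T) = sqnorm w *: (w *m w^T).
  by rewrite mulmxA -(mulmxA w) sqnorm_mul_trmx mul_mx_scalar -scalemxAl.
rewrite mulmxBl mul1mx mulmxBr mulmx1 -scalemxAl -scalemxAr wwww !scalerA.
have -> : c * c * sqnorm w = c + c by rewrite /c; field.
by rewrite scalerDl opprB addrK subrK.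
Qed.

(** With w = u - v, equality of the norms gives w'w = 2 (u'u - v'u) = 2 w'u. *)
Lemma householder_mul k (u v : 'cV[R]_k) : sqnorm u = sqnorm v ->
  householder u v *m u = v.
Proof.
move=> uv; rewrite /householder; case: eqVneq => [->|nuv]; first by rewrite mul1mx.
set w := u - v; rewrite -/(sqnorm w).
have w0 : sqnorm w != 0 by rewrite sqnorm_eq0 subr_eq0.
have wE (x : 'cV[R]_k) : (w^T *m x) 0 0 = (u^T *m x) 0 0 - (v^T *m x) 0 0.
  by rewrite (linearB trmx) mulmxBl !mxE.
have vu : (v^T *m u) 0 0 = (u^T *m v) 0 0.
  by rewrite -[in RHS](trmxK v) -trmx_mul [RHS]mxE.
have ww : sqnorm w = 2 * (sqnorm u - (u^T *m v) 0 0).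
  have : sqnorm w = (w^T *m u) 0 0 - (w^T *m v) 0 0 by rewrite /sqnorm mulmxBr !mxE.
  by rewrite !wE vu -!/(sqnorm _) -uv => ->; ring.
have wu : (w^T *m u) 0 0 = sqnorm w / 2.
  by rewrite wE vu -/(sqnorm u) ww; field.
rewrite mulmxBl mul1mx -scalemxAl -mulmxA (mx11_scalar (w^T *m u)) wu.
rewrite mul_mx_scalar scalerA (_ : _ * _ = 1); last by field.
by rewrite scale1r /w opprB addrC subrK.
Qed.

(** This removes the factor sqrt (1 - Gamma_11^2) from the reflections h_1 and
h_2, which do not depend on Gamma_11 as long as |Gamma_11| < 1. *)
Lemma householderZ k (c : R) (u v : 'cV[R]_k) : c != 0 ->
  householder (c *: u) (c *: v) = householder u v.
Proof.
move=> c0; rewrite /householder (inj_eq (scalerI c0)); case: eqVneq => // uv.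
rewrite -scalerBr; set w := u - v.
have w0 : sqnorm w != 0 by rewrite sqnorm_eq0 subr_eq0.
have wwT : (c *: w) *m (c *: w)^T = c ^+ 2 *: (w *m w^T).
  by rewrite [(c *: w)^T]linearZ/= -scalemxAl -scalemxAr scalerA expr2.
rewrite wwT -/(sqnorm (c *: w)) sqnormZ -/(sqnorm w) scalerA.
by congr (_ - _ *: _); field; rewrite w0 c0.
Qed.

End orthogonal_matrices.

Lemma measurable_orthogonal_group (R : realType) k :
  measurable (@orthogonal_group R k).
Proof.
have : measurable_fun setT (fun M : 'M[R]_k => M^T *m M == 1%:M).
  apply: measurable_eq_mx; last exact: measurable_cst.
  by apply: measurable_mulmx; first apply: measurable_trmx; exact: measurable_id.
move=> /(_ measurableT [set true]); rewrite setTI.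
rewrite (_ : _ @^-1` _ = @orthogonal_group R k); first exact.
by apply/seteqP; split => M /= /eqP.
Qed.

Lemma measurable_sqnorm (R : realType) k : measurable_fun setT (@sqnorm R k).
Proof.
apply: measurable_entry_comp; apply: measurable_mulmx; last exact: measurable_id.
by apply: measurable_trmx; exact: measurable_id.
Qed.

Lemma measurable_unit_sphere (R : realType) k : measurable (@unit_sphere R k).
Proof.
rewrite (_ : @unit_sphere R k = @sqnorm R k @^-1` [set 1]).
  by rewrite -[X in measurable X]setTI; exact: measurable_sqnorm.
by apply/seteqP; split => x /unit_sphereP.
Qed.

(** * Product measures and laws *)

Section sections.
Local Open Scope ereal_scope.
Context d1 d2 (T1 : measurableType d1) (T2 : measurableType d2) (R : realType).
Implicit Types C : set (T1 * T2).

Lemma xsection_set C x : xsection C x = [set y | C (x, y)].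
Proof. by apply/seteqP; split => y; rewrite /xsection/= inE. Qed.

Lemma ysection_set C y : ysection C y = [set x | C (x, y)].
Proof. by apply/seteqP; split => x; rewrite /ysection/= inE. Qed.

Lemma product_measure1_set (m1 : {measure set T1 -> \bar R})
    (m2 : {sigma_finite_measure set T2 -> \bar R}) C :
  (m1 \x m2) C = \int[m1]_x m2 [set y | C (x, y)].
Proof. by apply: eq_integral => x _ /=; rewrite xsection_set. Qed.

Lemma measurable_slice1 (m2 : {sigma_finite_measure set T2 -> \bar R}) C :
  measurable C -> measurable_fun setT (fun x => m2 [set y | C (x, y)]).
Proof.
move=> mC; have := measurable_fun_xsection m2 mC.
by apply: eq_measurable_fun => x _ /=; rewrite xsection_set.
Qed.

Lemma product_measure2_set (m1 : {sigma_finite_measure set T1 -> \bar R})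
    (m2 : {sigma_finite_measure set T2 -> \bar R}) C : measurable C ->
  (m1 \x m2) C = \int[m2]_y m1 [set x | C (x, y)].
Proof.
move=> mC; transitivity ((m1 \x^ m2) C).
  by apply: product_measure_unique => // A B mA mB; exact: product_measure2E.
by apply: eq_integral => y _ /=; rewrite ysection_set.
Qed.

(** Tonelli for an indicator function, in the form in which all averaging
arguments below use it. *)
Lemma section_swap (m1 : {sigma_finite_measure set T1 -> \bar R})
    (m2 : {sigma_finite_measure set T2 -> \bar R}) C : measurable C ->
  \int[m1]_x m2 [set y | C (x, y)] = \int[m2]_y m1 [set x | C (x, y)].
Proof. by move=> mC; rewrite -product_measure1_set product_measure2_set. Qed.

End sections.

Section integral_lemmas.
Local Open Scope ereal_scope.
Context d (T : measurableType d) (R : realType).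

Lemma eq_integral_full (mu : probability T R) (D : set T) (f g : T -> \bar R) :
  measurable D -> mu D = 1 -> measurable_fun setT f -> measurable_fun setT g ->
  (forall x, D x -> f x = g x) -> \int[mu]_x f x = \int[mu]_x g x.
Proof.
move=> mD muD mf mg fg; apply: ae_eq_integral => //.
exists (~` D); split; first exact: measurableC.
  by rewrite [LHS](probability_setC mu mD) muD subee.
by move=> x /= nfg Dx; apply: nfg => _; exact: fg.
Qed.

Lemma integral_full_cst (mu : probability T R) (D : set T) (f : T -> \bar R) c :
  measurable D -> mu D = 1 -> measurable_fun setT f ->
  (forall x, D x -> f x = c) -> \int[mu]_x f x = c.
Proof.
move=> mD muD mf fc.
rewrite (@eq_integral_full mu D f (cst c))//.
by rewrite integral_cst// [X in _ * X](probability_setT mu) mule1.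
Qed.

Lemma eq_integral_law d' (Y : measurableType d') (mu : {measure set T -> \bar R})
    d2 (T2 : measurableType d2) (mu2 : {measure set T2 -> \bar R})
    (f : T -> Y) (g : T2 -> Y) (h : Y -> \bar R) :
  measurable_fun setT f -> measurable_fun setT g -> measurable_fun setT h ->
  (forall y, 0 <= h y) ->
  (forall B, measurable B -> mu (f @^-1` B) = mu2 (g @^-1` B)) ->
  \int[mu]_x h (f x) = \int[mu2]_x h (g x).
Proof.
move=> mf mg mh h0 fg.
have := @ge0_integral_pushforward _ _ _ _ _ _ mf mu setT h measurableT mh (fun y _ => h0 y).
have := @ge0_integral_pushforward _ _ _ _ _ _ mg mu2 setT h measurableT mh (fun y _ => h0 y).
rewrite !preimage_setT => <- <-.
by apply: eq_measure_integral => A mA _; exact: fg.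
Qed.

End integral_lemmas.

Section independence.
Local Open Scope ereal_scope.
Context d (T : measurableType d) (R : realType) (P : probability T R).

Lemma independent_pair_law d1 (T1 : measurableType d1) d2 (T2 : measurableType d2)
    (X : {RV P >-> T1}) (Y : {RV P >-> T2}) :
  (forall A B, measurable A -> measurable B ->
    P (X @^-1` A `&` Y @^-1` B) = P (X @^-1` A) * P (Y @^-1` B)) ->
  forall C : set (T1 * T2), measurable C ->
  P [set t | C (X t, Y t)] = (distribution P X \x distribution P Y) C.
Proof.
move=> XY C mC.
have mXY : measurable_fun setT (fun t => (X t, Y t)).
  by apply: measurable_fun_pair; exact: measurable_funP.
pose XYf : {mfun T >-> (T1 * T2)%type} := HB.pack (fun t => (X t, Y t))
  (isMeasurableFun.Build _ _ _ _ _ mXY).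
rewrite (@product_measure_unique _ _ _ _ _ _ _ (distribution P XYf))//.
Qed.

End independence.

(** * Haar distributions from left invariance *)

Section haar.
Local Open Scope ereal_scope.
Variable R : realType.

Definition left_invariant k (mu : set 'M[R]_k -> \bar R) :=
  forall Q : 'M[R]_k, orthogonal_group Q -> forall B, measurable B ->
  mu [set A | B (Q *m A)] = mu B.

(** Both iterated integrals of 1_B(a' b) under mu(da) mu(db) are computed by left
invariance: integrating over b first gives mu(B), and integrating over a first
gives the measure of the transposes, since a' b = (b' a)'. *)
Lemma left_invariant_trmx k (mu : probability 'M[R]_k R) :
  mu (@orthogonal_group R k) = 1 -> left_invariant mu ->
  forall B, measurable B -> mu [set A | B A^T] = mu B.
Proof.
move=> mu1 linv B mB.
have mO := @measurable_orthogonal_group R k.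
pose C : set ('M[R]_k * 'M[R]_k) := [set p | B (p.1^T *m p.2)].
have mC : measurable C.
  rewrite -[C]setTI; apply: (_ : measurable_fun setT (fun p : 'M[R]_k * 'M[R]_k => p.1^T *m p.2)) => //.
  by apply: measurable_mulmx => //; exact: measurable_trmx.
have mT : measurable [set A : 'M[R]_k | B A^T].
  rewrite -[X in measurable X]setTI; apply: (_ : measurable_fun setT (fun p : 'M[R]_k => p^T)) => //.
  exact: measurable_trmx.
have := section_swap mu mu mC.
rewrite (@integral_full_cst _ _ _ mu (@orthogonal_group R k) _ (mu B))//; first last.
- by move=> A oA; exact: (linv _ (orthogonal_trmx oA) _ mB).
- exact: measurable_slice1.
rewrite (@integral_full_cst _ _ _ mu (@orthogonal_group R k) _ (mu [set A | B A^T]))//.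
  have := @measurable_fun_ysection _ _ _ _ _ mu _ mC.
  by apply: eq_measurable_fun => x _ /=; rewrite ysection_set.
move=> A oA; rewrite -(linv A^T)//; last exact: orthogonal_trmx.
by congr (mu _); apply/seteqP; split => Q /=; rewrite /C/= trmx_mul trmxK.
Qed.

(** Right multiplication by Q is left multiplication by Q' conjugated by
transposition. *)
Lemma left_invariant_haar k (mu : probability 'M[R]_k R) :
  mu (@orthogonal_group R k) = 1 -> left_invariant mu -> haar_distribution mu.
Proof.
move=> mu1 linv; split => // Q oQ B mB; split; first exact: linv.
have mQ : measurable ((fun A : 'M[R]_k => A *m Q) @^-1` B).
  rewrite -[X in measurable X]setTI; apply: (_ : measurable_fun setT (fun A : 'M[R]_k => A *m Q)) => //.
  by apply: measurable_mulmx => //; exact: measurable_cst.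
have mT : measurable [set A : 'M[R]_k | B A^T].
  rewrite -[X in measurable X]setTI; apply: (_ : measurable_fun setT (fun p : 'M[R]_k => p^T)) => //.
  exact: measurable_trmx.
rewrite -(left_invariant_trmx mu1 linv mQ) -(left_invariant_trmx mu1 linv mB).
rewrite -(linv _ (orthogonal_trmx oQ) _ mT).
by congr (mu _); apply/seteqP; split => A /=; rewrite trmx_mul trmxK.
Qed.

End haar.

Section extension.
Local Open Scope ereal_scope.
Context (R : realType) (k : nat) d (W : measurableType d) (omega : probability W R)
  (D : set W) (M : W -> 'M[R]_(1 + k)) (h : probability 'M[R]_k R).
Hypotheses (mD : measurable D) (omegaD : omega D = 1)
  (mM : measurable_fun setT M) (oM : forall w, D w -> orthogonal_group (M w))
  (hh : haar_distribution h).
Let e1 : 'cV[R]_(1 + k) := (delta_mx 0 0)%R.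
Hypothesis Me1 : forall Q : 'M[R]_(1 + k), orthogonal_group Q ->
  forall B, measurable B ->
  omega [set w | B (Q *m (M w *m e1))] = omega [set w | B (M w *m e1)].

(** The probability kappa(x) that N stab(psi) is in B, for N any orthogonal
matrix with N e1 = x, does not depend on the choice of N.  Conditionally on w
the probability that Q M(w) stab(psi) is in B is therefore kappa(Q M(w) e1), and
the law of M(w) e1 is invariant. *)
Lemma left_invariant_extension (Q : 'M[R]_(1 + k)) B :
  orthogonal_group Q -> measurable B ->
  (omega \x h) [set p | B (Q *m (M p.1 *m stab_mx p.2))] =
  (omega \x h) [set p | B (M p.1 *m stab_mx p.2)].
Proof.
move=> oQ mB.
pose kappa x := h [set psi | B (householder e1 x *m stab_mx psi)].
have mstab : measurable_fun setT (fun p : 'cV[R]_(1 + k) * 'M[R]_k =>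
    householder e1 p.1 *m stab_mx p.2).
  apply: measurable_mulmx; first by apply: measurable_householder => //; exact: measurable_cst.
  by apply: (@measurable_block_mx _ _ _ 1 k 1 k) => //; exact: measurable_cst.
have mkappa : measurable_fun setT kappa.
  apply: (@measurable_slice1 _ _ _ _ _ h [set p | B (householder e1 p.1 *m stab_mx p.2)]).
  by rewrite -[X in measurable X]setTI; exact: mstab.
have mstabB x : measurable [set psi | B (householder e1 x *m stab_mx psi)].
  rewrite -[X in measurable X]setTI.
  by have := measurable_fun_pair2 x mstab; apply.
have kappaE N : orthogonal_group N ->
    h [set psi | B (N *m stab_mx psi)] = kappa (N *m e1).
  move=> oN.
  have [||q oq NE] := @orthogonal_same_delta R k N (householder e1 (N *m e1)) oN.
  - exact: orthogonal_householder.
  - by rewrite householder_mul// sqnorm_orthogonal.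
  transitivity (h [set psi | B (householder e1 (N *m e1) *m stab_mx (q *m psi))]).
    by congr (h _); apply/seteqP; split => psi /=; rewrite stab_mxM mulmxA -NE.
  exact: (hh.2 q oq _ (mstabB (N *m e1))).1.
have mN (N : 'M[R]_(1 + k)) : measurable [set p | B (N *m (M p.1 *m stab_mx p.2))].
  rewrite -[X in measurable X]setTI; apply: (_ : measurable_fun setT
    (fun p : W * 'M[R]_k => N *m (M p.1 *m stab_mx p.2))) => //.
  apply: measurable_mulmx; first exact: measurable_cst.
  apply: measurable_mulmx; first exact: measurableT_comp.
  by apply: (@measurable_block_mx _ _ _ 1 k 1 k) => //; exact: measurable_cst.
have key N : orthogonal_group N ->
    (omega \x h) [set p | B (N *m (M p.1 *m stab_mx p.2))] =
    \int[omega]_w kappa (N *m (M w *m e1)).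
  move=> oN; rewrite product_measure1_set.
  apply: (@eq_integral_full _ _ _ omega D) => //.
  - exact: measurable_slice1.
  - apply: (measurableT_comp mkappa); apply: measurable_mulmx; first exact: measurable_cst.
    by apply: measurable_mulmx => //; exact: measurable_cst.
  move=> w Dw /=; rewrite mulmxA -kappaE//; last exact/orthogonal_mulmx/oM.
  by congr (h _); apply/seteqP; split => psi /=; rewrite mulmxA.
rewrite key//.
have := key _ (@orthogonal1 R _).
under eq_set do rewrite mul1mx.
move=> ->; under [RHS]eq_integral do rewrite mul1mx.
apply: eq_integral_law => //.
- apply: measurable_mulmx; first exact: measurable_cst.
  by apply: measurable_mulmx => //; exact: measurable_cst.
- by apply: measurable_mulmx => //; exact: measurable_cst.
- by move=> A mA; exact: Me1.
Qed.

End extension.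

(** * Lebesgue measure on column vectors *)

(** The proof of measurability is an argument so that the result is a measure. *)
Definition image_measure d1 d2 (T1 : measurableType d1) (T2 : measurableType d2)
  (R : realType) (mu : {measure set T1 -> \bar R}) (f : T1 -> T2)
  (mf : measurable_fun setT f) : {measure set T2 -> \bar R}.
Proof. by refine (pushforward mu f). Defined.

Section sigma_finite_measure_of.
Context d (T : measurableType d) (R : realType).
Variables (mu : {measure set T -> \bar R}) (sf : sigma_finite setT mu).

(** The proof is an argument so that the sigma-finite structure is inferred from
the term. *)
Definition sigma_finite_measure_of of sigma_finite setT mu : set T -> \bar R := mu.
Notation nu := (sigma_finite_measure_of sf).

Let nu0 : nu set0 = 0%E. Proof. exact: measure0. Qed.
Let nu_ge0 A : (0 <= nu A)%E. Proof. exact: measure_ge0. Qed.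
Let nu_additive : semi_sigma_additive nu. Proof. exact: measure_semi_sigma_additive. Qed.

HB.instance Definition _ := isMeasure.Build _ _ _ nu nu0 nu_ge0 nu_additive.
HB.instance Definition _ := Measure_isSigmaFinite.Build _ _ _ nu sf.

End sigma_finite_measure_of.

Section lebesgue_line.
Local Open Scope ereal_scope.
Context {R : realType}.
Notation leb := (@lebesgue_measure R).

Lemma lebesgue_measure_translate (a : R) (B : set R) : measurable B ->
  leb [set x | B (a + x)%R] = leb B.
Proof.
move=> mB; have mf : measurable_fun setT (fun x : measurableTypeR R => (a + x)%R : measurableTypeR R).
  by apply: measurable_funD => //; exact: measurable_cst.
apply/esym; apply: (@lebesgue_measure_unique R (pushforward leb (fun x : measurableTypeR R => (a + x)%R : measurableTypeR R))) => // _ [[x y]] _ <-.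
rewrite [RHS](_ : _ = leb `](x - a)%R, (y - a)%R]%classic); last congr (leb _).
  by rewrite !lebesgue_measure_itv/= !lte_fin ltrD2r -!EFinD; case: ifP => // _; congr (_%:E); ring.
by apply/seteqP; split => z /=; rewrite !in_itv/= ltrBlDl lerBrDl.
Qed.

Lemma lebesgue_measure_dilate (c : R) (B : set R) : (0 < c)%R -> measurable B ->
  c%:E * leb [set x | B (c * x)%R] = leb B.
Proof.
move=> c0 mB; have mf : measurable_fun setT (fun x : measurableTypeR R => (c * x)%R : measurableTypeR R).
  exact: mulrl_measurable.
pose k : {nonneg R} := NngNum (ltW c0).
apply/esym; apply: (@lebesgue_measure_unique R (mscale k (pushforward leb (fun x : measurableTypeR R => (c * x)%R : measurableTypeR R)))) => // _ [[x y]] _ <-.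
rewrite [RHS](_ : _ = c%:E * leb `](x / c)%R, (y / c)%R]%classic); last congr (_ * leb _).
  rewrite !lebesgue_measure_itv/= !lte_fin ltr_pM2r ?invr_gt0// -!EFinD; case: ifP => _.
    by rewrite -EFinM; congr (_%:E); field; rewrite gt_eqF.
  by rewrite mule0.
by apply/seteqP; split => z /=; rewrite !in_itv/= ltr_pdivrMr// ler_pdivlMr// mulrC.
Qed.

Lemma ge0_integral_translate (a : R) (f : R -> \bar R) :
  measurable_fun setT f -> (forall x, 0 <= f x) ->
  \int[leb]_x f (a + x)%R = \int[leb]_x f x.
Proof.
move=> mf f0; apply: (@eq_integral_law _ _ _ _ _ leb _ _ leb (fun x => a + x)%R id f) => //.
  by apply: measurable_funD => //; exact: measurable_cst.
by move=> B mB; exact: lebesgue_measure_translate.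
Qed.

Lemma ge0_integral_dilate (c : R) (f : R -> \bar R) : (0 < c)%R ->
  measurable_fun setT f -> (forall x, 0 <= f x) ->
  c%:E * \int[leb]_x f (c * x)%R = \int[leb]_x f x.
Proof.
move=> c0 mf f0; pose k : {nonneg R} := NngNum (ltW c0).
have mfc : measurable_fun setT (fun x => f (c * x)%R) by exact: measurableT_comp.
transitivity (\int[mscale k leb]_x f (c * x)%R).
  by rewrite ge0_integral_mscale.
apply: (@eq_integral_law _ _ _ _ _ (mscale k leb) _ _ leb (fun x => c * x)%R id f) => //.
  exact: mulrl_measurable.
by move=> B mB; exact: lebesgue_measure_dilate.
Qed.

End lebesgue_line.

Section lebesgue_column.
Local Open Scope ereal_scope.
Variable R : realType.

Definition translation_invariant k (mu : set 'cV[R]_k -> \bar R) :=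
  forall (a : 'cV[R]_k) (B : set 'cV[R]_k), measurable B ->
  mu [set v | B (a + v)%R] = mu B.

Definition cube k (r : R) : set 'cV[R]_k := [set v | forall i, (`|v i ord0| < r)%R].

Lemma measurable_cube k r : measurable (@cube k r).
Proof.
have -> : @cube k r = \bigcap_(i in [set: 'I_k])
    (fun v : 'cV[R]_k => v i ord0) @^-1` `](- r)%R, r[%classic.
  apply/seteqP; split => [v vr i _ /=|v vr i]; first by rewrite in_itv/= -ltr_norml.
  by have := vr i Logic.I; rewrite /= in_itv/= -ltr_norml.
apply: fin_bigcap_measurable => // i _; rewrite -[X in measurable X]setTI.
by apply: measurable_entry => //; exact: measurable_itv.
Qed.

(** Translation invariance together with the volume of cubes; the cubes serve for
sigma-finiteness and as a normalization. *)
Definition is_lebesgue k (mu : set 'cV[R]_k -> \bar R) :=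
  translation_invariant mu /\
  forall r, (0 < r)%R -> mu (@cube k r) = ((2 * r) ^+ k)%:E.

Lemma is_lebesgue_sigma_finite k (mu : set 'cV[R]_k -> \bar R) :
  is_lebesgue mu -> sigma_finite setT mu.
Proof.
move=> [_ muc]; exists (fun j => @cube k j.+1%:R).
  apply/esym/seteqP; split => // v _.
  pose b := (\sum_i `|v i ord0|)%R.
  exists (Num.truncn b) => // i.
  apply: le_lt_trans (Num.Theory.truncnS_gt b).
  by rewrite /b (bigD1 i)//= lerDl sumr_ge0.
by move=> j; split; [exact: measurable_cube|rewrite muc// ltry].
Qed.

(** The identification of R x R^k with R^(1+k). *)
Definition cons_col k (p : R * 'cV[R]_k) : 'cV[R]_(1 + k) := col_mx p.1%:M p.2.

Lemma measurable_cons_col k : measurable_fun setT (@cons_col k).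
Proof. by apply: measurable_col_mx => //; exact: measurable_scalar_mx. Qed.

Lemma is_lebesgue_cons k (mu : {sigma_finite_measure set 'cV[R]_k -> \bar R}) :
  is_lebesgue mu ->
  is_lebesgue (image_measure (@lebesgue_measure R \x mu) (@measurable_cons_col k)).
Proof.
move=> [mut muc]; split=> [a B mB|r r0].
  have mpre (A : set 'cV[R]_(1 + k)) : measurable A -> measurable (@cons_col k @^-1` A).
    by move=> mA; rewrite -[X in measurable X]setTI; exact: measurable_cons_col.
  rewrite /image_measure /= /pushforward !product_measure1_set /=.
  pose g x := mu [set v | B (@cons_col k (x, v))].
  have mg : measurable_fun setT g by exact: (measurable_slice1 mu (mpre B mB)).
  rewrite -(@ge0_integral_translate _ (usubmx a ord0 ord0) g)//.
  apply: eq_integral => x _; rewrite /g.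
  have mBx : measurable [set v | B (@cons_col k (usubmx a ord0 ord0 + x, v)%R)].
    by rewrite -(xsection_set (@cons_col k @^-1` B)); apply: measurable_xsection; exact: mpre.
  rewrite -(mut (dsubmx a) _ mBx).
  have aE v : (a + @cons_col k (x, v) = @cons_col k (usubmx a ord0 ord0 + x, dsubmx a + v))%R.
    by rewrite /cons_col/= -[in LHS](vsubmxK a) add_col_mx [X in (X + _)%R]mx11_scalar -raddfD.
  by congr (mu _); apply/seteqP; split => v /=; rewrite aE.
rewrite /image_measure /= /pushforward (_ : _ @^-1` _ = `](- r)%R, r[%classic `*` @cube k r).
  rewrite product_measure1E//; last exact: measurable_cube.
  have lebE : @lebesgue_measure R `](- r)%R, r[%classic = (2 * r)%:E.
    by rewrite lebesgue_measure_itv/= lte_fin gtrN// -EFinD; congr (_%:E); ring.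
  by rewrite muc// [X in X * _](_ : _ = (2 * r)%:E)// exprS.
apply/seteqP; split => [[x v] xv|[x v] [/= xr vr] i]; first split => /=.
- by have := xv (lshift k ord0); rewrite /cons_col col_mxEu mxE eqxx in_itv/= ltr_norml.
- by move=> i; have := xv (rshift 1 i); rewrite /cons_col col_mxEd.
- rewrite /cons_col; case: (split_ordP i) => j ->.
    by rewrite col_mxEu mxE !ord1 eqxx ltr_norml; rewrite in_itv in xr.
  by rewrite col_mxEd; exact: vr.
Qed.

Lemma exists_lebesgue k :
  exists mu : {sigma_finite_measure set 'cV[R]_k -> \bar R}, is_lebesgue mu.
Proof.
elim: k => [|k [mu muL]].
  exists (dirac (0 : 'cV[R]_0)%R); split=> [a B mB|r r0] /=.
    congr (dirac _ _); apply/seteqP; split => v /=; by rewrite (flatmx0 (a + v)%R) (flatmx0 v).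
  by rewrite diracE mem_set//; case.
have muL' := is_lebesgue_cons muL.
by exists (sigma_finite_measure_of (is_lebesgue_sigma_finite muL')).
Qed.

End lebesgue_column.

(** * Uniqueness and symmetries of Lebesgue measure *)

(** Constants that are finite and positive are cancelled with this lemma. *)
Lemma mule_pinj (R : realType) (z x y : \bar R) : z \is a fin_num -> (0 < z)%E ->
  (z * x = z * y)%E -> x = y.
Proof.
by move=> zf z0 /eqP; rewrite eq_le !lee_pmul2l// -eq_le => /eqP.
Qed.

Section lebesgue_uniqueness.
Local Open Scope ereal_scope.
Variables (R : realType) (k : nat).

Lemma measurable_slice_and d1 d2 (T1 : measurableType d1) (T2 : measurableType d2)
    (mu : {measure set T2 -> \bar R}) (A : set T1) (E : set T2) x :
  measurable E -> mu [set y | A x /\ E y] = (\1_A x)%:E * mu E.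
Proof.
move=> mE; rewrite indicE; have [/set_mem Ax|/negP nAx] := boolP (x \in A).
  by rewrite mul1e; congr (mu _); apply/seteqP; split => y //= -[].
rewrite mul0e -[RHS](measure0 mu); congr (mu _).
by apply/seteqP; split => y //= -[Ax _]; apply: nAx; exact/mem_set.
Qed.

(** Both sides are the integral of 1_A(x) 1_B(x + y) over la(dx) mu(dy): for the
left side one translates y by x, for the right side one translates x by -y and
then y by x. *)
Lemma translation_invariant_swap (la mu : {sigma_finite_measure set 'cV[R]_k -> \bar R})
    (A B : set 'cV[R]_k) :
  translation_invariant la -> translation_invariant mu ->
  measurable A -> measurable B ->
  la A * mu B = la B * mu [set v | A (- v)%R].
Proof.
move=> lat mut mA mB.
have mlin (a b : R) (D : set 'cV[R]_k) : measurable D ->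
    measurable [set p : 'cV[R]_k * 'cV[R]_k | D (a *: p.1 + b *: p.2)%R].
  move=> mD; rewrite -[X in measurable X]setTI.
  apply: (_ : measurable_fun setT (fun p : 'cV[R]_k * 'cV[R]_k => a *: p.1 + b *: p.2)%R) => //.
  by apply: measurable_addmx; apply: measurable_scalemx => //; exact: measurable_cst.
have mC1 : measurable [set p : 'cV[R]_k * 'cV[R]_k | A p.1 /\ B (p.1 + p.2)%R].
  apply: measurableI.
    by rewrite -[X in measurable X]setTI; exact: measurable_fst.
  by have := mlin 1%R 1%R B mB; congr measurable; apply/seteqP; split => p /=; rewrite !scale1r.
have mC2 : measurable [set p : 'cV[R]_k * 'cV[R]_k | B p.1 /\ A (p.1 - p.2)%R].
  apply: measurableI.
    by rewrite -[X in measurable X]setTI; exact: measurable_fst.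
  by have := mlin 1%R (-1)%R A mA; congr measurable; apply/seteqP; split => p /=; rewrite scale1r scaleN1r.
have mN : measurable [set v | A (- v)%R].
  rewrite -[X in measurable X]setTI; apply: (_ : measurable_fun setT (fun v : 'cV[R]_k => - v)%R) => //.
  under eq_fun do rewrite -scaleN1r.
  by apply: measurable_scalemx => //; exact: measurable_cst.
have mT (D : set 'cV[R]_k) a : measurable D -> measurable [set v | D (a + v)%R].
  move=> mD; rewrite -[X in measurable X]setTI; apply: (_ : measurable_fun setT (fun v : 'cV[R]_k => a + v)%R) => //.
  by apply: measurable_addmx => //; exact: measurable_cst.
have integral_side (D : set 'cV[R]_k) c : measurable D -> 0 <= c ->
    \int[la]_x ((\1_D x)%:E * c) = la D * c.
  move=> mD c0; rewrite ge0_integralZr//; first by rewrite integral_indic// setIT.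
  by apply/measurable_EFinP; exact: measurable_indic.
transitivity (\int[la]_x mu [set y | A x /\ B (x + y)%R]).
  rewrite -integral_side//; apply: eq_integral => x _.
  rewrite (measurable_slice_and mu A x (mT B x mB)); congr (_ * _).
  exact/esym/(mut x _ mB).
rewrite (section_swap la mu mC1)/=.
transitivity (\int[mu]_y la [set x | B x /\ A (x - y)%R]).
  apply: eq_integral => y _.
  have m1 : measurable [set x | A x /\ B (x + y)%R].
    by have := measurable_ysection y mC1; rewrite ysection_set.
  rewrite -[LHS](lat (- y)%R _ m1).
  by congr (la _); apply/seteqP; split => x /=; rewrite addrAC addNr add0r (addrC (- y)%R) => -[].
rewrite -(section_swap la mu mC2)/= -integral_side//; apply: eq_integral => x _.
have m2 : measurable [set y | A (x - y)%R].
  have := mT _ (- x)%R mN; congr measurable; apply/seteqP; split => y /=;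
  by rewrite opprD opprK.
rewrite (measurable_slice_and mu B x m2); congr (_ * _).
rewrite -[LHS](mut x _ m2).
by congr (mu _); apply/seteqP; split => y /=; rewrite opprD addrA subrr add0r.
Qed.

Variable la : {sigma_finite_measure set 'cV[R]_k -> \bar R}.
Hypothesis laL : is_lebesgue la.

(** The previous identity for A the cube of half-side 1, which is symmetric. *)
Lemma lebesgue_unique (mu : {measure set 'cV[R]_k -> \bar R}) :
  translation_invariant mu -> (forall r, (0 < r)%R -> mu (@cube R k r) < +oo) ->
  forall B, measurable B -> (2 ^+ k)%:E * mu B = la B * mu (@cube R k 1).
Proof.
move=> mut mufin B mB.
have sf : sigma_finite setT mu.
  exists (fun j => @cube R k j.+1%:R); last by move=> j; split; [exact: measurable_cube|exact: mufin].
  apply/esym/seteqP; split => // v _.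
  pose b := (\sum_i `|v i ord0|)%R.
  exists (Num.truncn b) => // i.
  apply: le_lt_trans (Num.Theory.truncnS_gt b).
  by rewrite /b (bigD1 i)//= lerDl sumr_ge0.
have := translation_invariant_swap laL.1 (mut : translation_invariant (sigma_finite_measure_of sf)) (@measurable_cube R k 1) mB.
rewrite laL.2// mulr1 /sigma_finite_measure_of => ->; congr (_ * mu _).
by apply/seteqP; split => v vr i; have := vr i; rewrite !mxE normrN.
Qed.

Lemma measurable_sqnorm_lt (r : R) : measurable [set v : 'cV[R]_k | (sqnorm v < r)%R].
Proof.
rewrite (_ : [set _ | _] = @sqnorm R k @^-1` `]-oo, r[%classic).
  by rewrite -[X in measurable X]setTI; exact: measurable_sqnorm.
by apply/seteqP; split => v /=; rewrite in_itv.
Qed.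

Lemma lebesgue_ball_gt0 : 0 < la [set v | (sqnorm v < 1)%R].
Proof.
have k0 : (0 < k.+1%:R^-1 :> R)%R by rewrite invr_gt0.
(* the cube of half-side 1/(k+1) lies in the unit ball, as k/(k+1)^2 < 1 *)
apply: (@lt_le_trans _ _ (la (@cube R k k.+1%:R^-1))).
  by rewrite laL.2// lte_fin exprn_gt0// mulr_gt0.
apply: le_measure; rewrite ?inE; [exact: measurable_cube|exact: measurable_sqnorm_lt|].
move=> v vr /=; rewrite sqnormE.
apply: (@le_lt_trans _ _ (\sum_(i < k) k.+1%:R^-1)%R).
  apply: ler_sum => i _; rewrite -real_normK ?num_real//.
  apply: (@le_trans _ _ (k.+1%:R^-1 ^+ 2)%R).
    by rewrite lerXn2r ?nnegrE// ltW.
  by rewrite expr2 ger_pMr// invf_le1// ler1n.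
by rewrite sumr_const card_ord -[X in (X < _)%R]mulr_natr mulrC ltr_pdivrMr// mul1r ltr_nat.
Qed.

Lemma sqnorm_ge_entry (v : 'cV[R]_k) i : (`|v i ord0| ^+ 2 <= sqnorm v)%R.
Proof.
rewrite real_normK ?num_real// sqnormE (bigD1 i)//= lerDl sumr_ge0// => j _; exact: sqr_ge0.
Qed.

Lemma lebesgue_ball_lty : la [set v | (sqnorm v < 1)%R] < +oo.
Proof.
apply: (@le_lt_trans _ _ (la (@cube R k 1))); last by rewrite laL.2// ltry.
apply: le_measure; rewrite ?inE; [exact: measurable_sqnorm_lt|exact: measurable_cube|].
move=> v /= v1 i; rewrite -(@ltr_pXn2r _ 2)// ?nnegrE// expr1n.
exact: le_lt_trans (sqnorm_ge_entry v i) v1.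
Qed.

(** The image of la by an orthogonal matrix is proportional to la, and the factor
is 1 because the unit ball is preserved. *)
Lemma lebesgue_orthogonal (Q : 'M[R]_k) B : orthogonal_group Q -> measurable B ->
  la [set v | B (Q *m v)] = la B.
Proof.
move=> oQ mB.
have mQ : measurable_fun setT (fun v : 'cV[R]_k => Q *m v).
  by apply: measurable_mulmx => //; exact: measurable_cst.
pose mu := image_measure la mQ.
have mut : translation_invariant mu.
  move=> a A mA.
  have mQA : measurable [set v | A (Q *m v)].
    by rewrite -[X in measurable X]setTI; exact: (mQ measurableT A mA).
  rewrite /mu/= /pushforward -[RHS](laL.1 (Q^T *m a) _ mQA).
  congr (la _); apply/seteqP; split => v /=;
  by rewrite mulmxDr mulmxA orthogonal_mulmxV// mul1mx.
have muc r : (0 < r)%R -> mu (@cube R k r) < +oo.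
  move=> r0; have kr0 : (0 < k.+1%:R * r)%R by rewrite mulr_gt0.
  apply: (@le_lt_trans _ _ (la (@cube R k (k.+1%:R * r)))); last by rewrite laL.2// ltry.
  change (la [set v | @cube R k r (Q *m v)] <= la (@cube R k (k.+1%:R * r))).
  apply: le_measure; rewrite ?inE; [|exact: measurable_cube|].
    by rewrite -[X in measurable X]setTI; exact: (mQ measurableT _ (@measurable_cube R k r)).
  move=> v /= vr i; rewrite -(@ltr_pXn2r _ 2)// ?nnegrE//; last exact: ltW.
  apply: le_lt_trans (sqnorm_ge_entry v i) _; rewrite -(sqnorm_orthogonal v oQ) sqnormE.
  apply: (@le_lt_trans _ _ (\sum_(i < k) r ^+ 2)%R).
    by apply: ler_sum => j _; rewrite -real_normK ?num_real// lerXn2r ?nnegrE// ltW//; exact: vr.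
  rewrite sumr_const card_ord -[X in (X < _)%R]mulr_natl exprMn ltr_pM2r ?exprn_gt0//.
  by rewrite -natrX ltr_nat (leq_trans (ltnSn k))// -mulnn leq_pmulr.
have key := lebesgue_unique mut muc.
set D := [set v : 'cV[R]_k | (sqnorm v < 1)%R].
have muD : mu D = la D.
  by congr (la _); apply/seteqP; split => v; rewrite /D/= sqnorm_orthogonal.
have laD : la D \is a fin_num.
  by rewrite ge0_fin_numE//; exact: lebesgue_ball_lty.
have pow2 : 0 < (2 ^+ k)%:E :> \bar R by rewrite lte_fin exprn_gt0.
have mucube : mu (@cube R k 1) = (2 ^+ k)%:E.
  apply: (mule_pinj laD lebesgue_ball_gt0).
  by rewrite -key ?muD 1?muleC//; exact: measurable_sqnorm_lt.
apply: (mule_pinj _ pow2) => //.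
by rewrite [LHS](key B mB) mucube muleC.
Qed.

(** The factor of proportionality is read off on the unit cube. *)
Lemma lebesgue_dilate (c : R) (B : set 'cV[R]_k) : (0 < c)%R -> measurable B ->
  (c ^+ k)%:E * la [set v | B (c *: v)%R] = la B.
Proof.
move=> c0 mB.
have mc : measurable_fun setT (fun v : 'cV[R]_k => c *: v)%R.
  by apply: measurable_scalemx => //; exact: measurable_cst.
pose mu := image_measure la mc.
have mut : translation_invariant mu.
  move=> a A mA.
  have mcA : measurable [set v | A (c *: v)%R].
    by rewrite -[X in measurable X]setTI; exact: (mc measurableT A mA).
  rewrite /mu/= /pushforward -[RHS](laL.1 (c^-1 *: a)%R _ mcA).
  congr (la _); apply/seteqP; split => v /=;
  by rewrite scalerDr scalerA divff ?gt_eqF// scale1r.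
have mucE r : (0 < r)%R -> mu (@cube R k r) = ((2 * (r / c)) ^+ k)%:E.
  move=> r0; rewrite -laL.2 ?divr_gt0//; congr (la _).
  by apply/seteqP; split => v vr i; have := vr i; rewrite mxE normrM (gtr0_norm c0) ltr_pdivlMr// mulrC.
have := lebesgue_unique mut _ mB; rewrite mucE// => key.
have {}key : (2 ^+ k)%:E * mu B = la B * ((2 * (1 / c)) ^+ k)%:E.
  by apply: key => r r0; rewrite mucE// ltry.
have pow2 : 0 < (2 ^+ k)%:E :> \bar R by rewrite lte_fin exprn_gt0.
apply: (mule_pinj _ pow2) => //.
rewrite muleCA [X in _ * X]key muleCA -EFinM muleC; congr (_%:E * _).
by rewrite -exprMn; congr (_ ^+ _)%R; field; rewrite gt_eqF.
Qed.

End lebesgue_uniqueness.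

(** * The law of the squared norm *)

Section densities.
Local Open Scope ereal_scope.
Context d (T : measurableType d) (R : realType) (mu : {measure set T -> \bar R}).
Variables (f : T -> R) (mf : measurable_fun setT f) (f0 : forall x, (0 <= f x)%R).

(** The properties of f are arguments so that the measure structure is inferred
from the term. *)
Definition density_measure of measurable_fun setT f & (forall x, (0 <= f x)%R) :=
  fun A : set T => \int[mu]_(x in A) (f x)%:E.
Notation nu := (density_measure mf f0).

Let nu_set0 : nu set0 = 0. Proof. exact: integral_set0. Qed.

Let nu_ge0 A : 0 <= nu A.
Proof. by apply: integral_ge0 => x _; rewrite lee_fin. Qed.

Let nu_sigma_additive : semi_sigma_additive nu.
Proof.
move=> F mF tF mUF; rewrite [X in _ --> X](_ : _ = \sum_(n <oo) nu (F n)).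
  by apply/cvg_closeP; split; [exact: is_cvg_nneseries|rewrite closeE].
rewrite /density_measure ge0_integral_bigcup//.
- by apply/measurable_EFinP; exact: measurable_funTS.
- by move=> x _; rewrite lee_fin.
Qed.

HB.instance Definition _ := isMeasure.Build _ _ _ nu nu_set0 nu_ge0 nu_sigma_additive.

Import HBNNSimple.

Lemma ge0_integral_density (la : {measure set T -> \bar R}) (G : T -> \bar R) :
  (forall A, measurable A -> la A = nu A) ->
  measurable_fun setT G -> (forall x, 0 <= G x) ->
  \int[la]_x G x = \int[mu]_x ((f x)%:E * G x).
Proof.
move=> lanu mG G0; pose h := nnsfun_approx measurableT mG.
have mEf : measurable_fun setT (fun x => (f x)%:E) by exact/measurable_EFinP.
have GE x : G x = limn (fun n => (h n x)%:E).
  by apply/esym/cvg_lim => //; exact: cvg_nnsfun_approx.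
transitivity (limn (fun n => \int[la]_x (h n x)%:E)).
  under eq_integral do rewrite GE.
  apply: monotone_convergence => //.
  - by move=> n; exact/measurable_EFinP/measurable_funP.
  - by move=> n x _; rewrite lee_fin.
  - by move=> x _ a b ab; rewrite lee_fin; exact/lefP/nd_nnsfun_approx.
transitivity (limn (fun n => \int[mu]_x ((f x)%:E * (h n x)%:E))); last first.
  have fGE x : (f x)%:E * G x = limn (fun n => (f x)%:E * (h n x)%:E).
    by apply/esym/cvg_lim => //; apply: cvgeZl => //; exact: cvg_nnsfun_approx.
  under [RHS]eq_integral do rewrite fGE.
  apply/esym/monotone_convergence => //.
  - by move=> n; apply: emeasurable_funM => //; exact/measurable_EFinP/measurable_funP.
  - by move=> n x _; rewrite mule_ge0// lee_fin.
  - by move=> x _ a b ab; rewrite lee_wpmul2l ?lee_fin//; exact/lefP/nd_nnsfun_approx.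
congr (limn _); apply/funext => n.
transitivity (\int[la]_x (\sum_(y \in range (h n)) (y * \1_(h n @^-1` [set y]) x)%:E)).
  by apply: eq_integral => t _; rewrite /= fimfunE -fsumEFin.
rewrite ge0_integral_fsum//; last 2 first.
- by move=> r; exact/measurable_EFinP/measurable_funM.
- by move=> y x _; exact: nnfun_muleindic_ge0.
transitivity (\int[mu]_x (\sum_(y \in range (h n)) ((f x)%:E * (y * \1_(h n @^-1` [set y]) x)%:E))); last first.
  apply: eq_integral => x _; rewrite -ge0_mule_fsumr => [|y]; last exact: nnfun_muleindic_ge0.
  by rewrite fsumEFin// -(fimfunE _ x).
rewrite ge0_integral_fsum//; last 2 first.
- by move=> r; apply: emeasurable_funM => //; exact/measurable_EFinP/measurable_funM.
- by move=> y x _; apply: mule_ge0; [rewrite lee_fin|exact: nnfun_muleindic_ge0].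
apply: eq_fsbigr => r /[!inE] -[x _ rx].
have r0 : (0 <= r)%R by rewrite -rx.
rewrite integralZl_indic_nnsfun// integral_indic// setIT.
under eq_integral do rewrite EFinM muleCA.
rewrite ge0_integralZl//; last 2 first.
- by apply: emeasurable_funM => //; exact/measurable_EFinP/measurable_indic.
- by move=> y _; rewrite mule_ge0// lee_fin.
congr (_ * _); rewrite lanu// /density_measure integral_mkcond.
apply: eq_integral => y _; rewrite patchE indicE.
by case: ifPn => _; rewrite ?mule1// mule0.
Qed.

End densities.

Lemma measure_unique_rays (R : realType) (m1 m2 : {measure set (measurableTypeR R) -> \bar R}) :
  (forall x, m1 `]-oo, x[%classic = m2 `]-oo, x[%classic) ->
  (forall x, m1 `]-oo, x[%classic < +oo)%E ->
  forall C, measurable C -> m1 C = m2 C.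
Proof.
move=> m12 m1oo C mC.
pose g (j : nat) : set (measurableTypeR R) := `]-oo, j%:R[%classic.
apply: (@measure_unique _ R (measurableTypeR R) (@measurable_realfun.RGenInftyO.G R) g) => //.
- exact: measurable_realfun.RGenInftyO.measurableE.
- move=> _ _ [x ->] [y ->]; exists (Num.min x y).
  by apply/seteqP; split => z /=; rewrite !in_itv/= lt_min => /andP.
- by move=> j; exists j%:R.
- apply/seteqP; split => // x _; exists (Num.truncn `|x|).+1 => //=.
  rewrite /g/= in_itv/=; apply: le_lt_trans (Num.Theory.truncnS_gt _); exact: ler_norm.
- by move=> _ [x ->].
- by move=> j; exact: m1oo.
Qed.

Section radial_law.
Local Open Scope ereal_scope.
Context {R : realType}.
Variable n : nat.
Notation leb := (@lebesgue_measure R).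

(** The function t^(n/2) on t > 0, written with a square root so that only natural
exponents occur.  Here n = m - 2, where m is the dimension of the column
vectors. *)
Definition radial_weight (x : R) : R := if (0 < x)%R then (Num.sqrt x ^+ n)%R else 0%R.
Local Notation wt := radial_weight.

Lemma radial_weight_ge0 x : (0 <= wt x)%R.
Proof. by rewrite /wt; case: ifP => // _; rewrite exprn_ge0. Qed.

Lemma measurable_radial_weight : measurable_fun setT wt.
Proof.
apply: measurable_fun_ifT.
- by apply: measurable_fun_ltr => //; exact: measurable_cst.
- by apply: measurable_funX; exact: measurable_sqrtr.
- exact: measurable_cst.
Qed.

Lemma radial_weightM t x : (0 < t)%R -> wt (t * x)%R = (Num.sqrt t ^+ n * wt x)%R.
Proof.
move=> t0; rewrite /wt pmulr_rgt0//; case: ifP => _; last by rewrite mulr0.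
by rewrite sqrtrM ?ltW// exprMn.
Qed.

(** The integral of t^(n/2) over 0 < t < 1.  It is kept as a finite positive constant. *)
Definition radial_mass : \bar R := \int[leb]_x (wt x * (x < 1)%R%:R)%:E.

Lemma measurable_radial_integrand :
  measurable_fun setT (fun x : R => (wt x * (x < 1)%R%:R)%:E).
Proof.
apply/measurable_EFinP; apply: measurable_funM; first exact: measurable_radial_weight.
have -> : (fun x : R => (x < 1)%R%:R : R) = (fun x => if (x < 1)%R then 1%R else 0%R : R).
  by apply/funext => x; case: ifP.
apply: measurable_fun_ifT; try exact: measurable_cst.
by apply: measurable_fun_ltr => //; exact: measurable_cst.
Qed.

Lemma radial_mass_lty : radial_mass < +oo.
Proof.
apply: (@le_lt_trans _ _ (\int[leb]_x (\1_`]0%R, 1%R[%classic x)%:E)).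
  apply: ge0_le_integral => //.
  - by move=> x _; rewrite lee_fin mulr_ge0// radial_weight_ge0.
  - exact: measurable_radial_integrand.
  - by apply/measurable_EFinP; exact: measurable_indic.
  - move=> x _; rewrite lee_fin indicE mem_setE in_itv/= /wt.
    case: ltP => [x0|_]; last by rewrite mul0r.
    case: ltP => [x1|_]; last by rewrite mulr0.
    by rewrite mulr1 exprn_ile1// -[leRHS]sqrtr1 ler_wsqrtr// ltW.
have leb01 : leb `]0%R, 1%R[%classic = 1.
  by rewrite lebesgue_measure_itv/= lte_fin ltr01 -EFinD subr0.
by rewrite integral_indic// setIT [X in X < _]leb01 ltry.
Qed.

Lemma radial_mass_gt0 : 0 < radial_mass.
Proof.
(* on (1/4, 1) the weight is at least (1/2)^n *)
apply: (@lt_le_trans _ _ (\int[leb]_x ((2^-1 ^+ n)%:E * (\1_`](4^-1)%R, 1%R[%classic x)%:E))).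
  rewrite ge0_integralZl//; last by apply/measurable_EFinP; exact: measurable_indic.
  have leb41 : leb `](4^-1)%R, 1%R[%classic = (1 - 4^-1)%:E.
    by rewrite lebesgue_measure_itv/= lte_fin invf_lt1// ltr1n.
  rewrite integral_indic// setIT [X in _ * X]leb41 -EFinM lte_fin mulr_gt0//.
  by rewrite subr_gt0 invf_lt1// ltr1n.
apply: ge0_le_integral => //.
- by apply: emeasurable_funM => //; apply/measurable_EFinP; exact: measurable_indic.
- exact: measurable_radial_integrand.
move=> x _; rewrite -EFinM lee_fin indicE mem_setE in_itv/=.
case: (boolP (4^-1 < x)%R) => [x4|_]; last by rewrite mulr0 mulr_ge0// radial_weight_ge0.
rewrite /= ler_wpM2r// /wt (lt_trans _ x4) ?invr_gt0//.
rewrite lerXn2r ?nnegrE ?invr_ge0//.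
have -> : (2^-1 = Num.sqrt (4^-1) :> R)%R.
  by rewrite -[(4^-1)%R](_ : (2^-1 ^+ 2)%R = _) ?sqrtr_sqr ?ger0_norm ?invr_ge0//; field.
by rewrite ler_wsqrtr// ltW.
Qed.

(** By the substitution t x the weight is homogeneous of degree n/2, so that the
mass of (0, t) is homogeneous of degree n/2 + 1; this avoids any
antiderivative. *)
Lemma radial_measure_ray t : (0 < t)%R ->
  \int[leb]_(x in `]-oo, t[) (wt x)%:E = (Num.sqrt t ^+ n.+2)%:E * radial_mass.
Proof.
move=> t0.
transitivity (\int[leb]_x (wt x * (t^-1 * x < 1)%R%:R)%:E).
  rewrite integral_mkcond; apply: eq_integral => x _.
  rewrite patchE mem_setE in_itv/= [(t^-1 * x)%R]mulrC ltr_pdivrMr// mul1r.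
  by case: ifP => _; rewrite ?mulr1// mulr0.
have mF : measurable_fun setT (fun x : R => (wt x * (t^-1 * x < 1)%R%:R)%:E).
  have -> : (fun x : R => (wt x * (t^-1 * x < 1)%R%:R)%:E) =
      (fun x : R => ((Num.sqrt t ^+ n)%:E * (wt (t^-1 * x) * (t^-1 * x < 1)%R%:R)%:E)).
    apply/funext => x; rewrite -EFinM mulrA -radial_weightM//.
    by rewrite mulrA divff ?gt_eqF// mul1r.
  apply: emeasurable_funM => //.
  exact: (measurableT_comp measurable_radial_integrand).
rewrite -(ge0_integral_dilate t0)//; last first.
  by move=> x; rewrite lee_fin mulr_ge0// radial_weight_ge0.
have -> : (Num.sqrt t ^+ n.+2 = t * Num.sqrt t ^+ n)%R.
  by rewrite !exprS mulrA -expr2 sqr_sqrtr ?ltW.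
rewrite EFinM -muleA; congr (_ * _).
rewrite /radial_mass -ge0_integralZl//; last 2 first.
- exact: measurable_radial_integrand.
- by move=> x _; rewrite lee_fin mulr_ge0// radial_weight_ge0.
apply: eq_integral => x _.
by rewrite radial_weightM// mulrA mulVf ?gt_eqF// mul1r -mulrA EFinM.
Qed.

Variable la : {sigma_finite_measure set 'cV[R]_n.+2 -> \bar R}.
Hypothesis laL : is_lebesgue la.
Let kappa := la [set v | (sqnorm v < 1)%R].

(** The ball of squared radius t is the unit ball dilated by sqrt t. *)
Lemma lebesgue_ball t : (0 < t)%R ->
  la [set v | (sqnorm v < t)%R] = (Num.sqrt t ^+ n.+2)%:E * kappa.
Proof.
move=> t0; rewrite -(@lebesgue_dilate _ _ la laL (Num.sqrt t))//; last 2 first.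
- by rewrite sqrtr_gt0.
- exact: measurable_sqnorm_lt.
congr (_ * la _); apply/seteqP; split => v /=;
by rewrite sqnormZ sqr_sqrtr ?ltW// mulrC -ltr_pdivlMr// divff// gt_eqF.
Qed.

(** Both sides are measures in C, with the same values on half-lines by
homogeneity. *)
Lemma sqnorm_law C : measurable C ->
  radial_mass * la [set v | C (sqnorm v)] = kappa * \int[leb]_(x in C) (wt x)%:E.
Proof.
have kappa0 : 0 <= kappa by exact: measure_ge0.
have rf : radial_mass \is a fin_num.
  by rewrite ge0_fin_numE ?radial_mass_lty// ltW// radial_mass_gt0.
have kf : kappa \is a fin_num by rewrite ge0_fin_numE//; exact: lebesgue_ball_lty.
pose r := NngNum (fine_ge0 (ltW radial_mass_gt0)).
pose k := NngNum (fine_ge0 kappa0).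
pose m1 : {measure set (measurableTypeR R) -> \bar R} := mscale r (@image_measure _ _ _ (measurableTypeR R) R la _ (@measurable_sqnorm R n.+2)).
pose m2 : {measure set (measurableTypeR R) -> \bar R} := mscale k (density_measure leb measurable_radial_weight radial_weight_ge0).
have m1E A : m1 A = radial_mass * la [set v | A (sqnorm v)].
  by rewrite -[X in X * _](fineK rf).
have m2E A : m2 A = kappa * \int[leb]_(x in A) (wt x)%:E.
  by rewrite -[X in X * _](fineK kf).
have rayE (x : R) : m1 `]-oo, x[%classic = m2 `]-oo, x[%classic.
  rewrite m1E m2E.
  have [x0|x0] := leP x 0%R.
    rewrite [X in la X](_ : _ = set0) ?measure0 ?mule0; last first.
      apply/seteqP; split => v //=; rewrite in_itv/= => vx.
      by have := lt_le_trans vx x0; rewrite ltNge sqnorm_ge0.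
    rewrite integral0_eq ?mule0// => y /=; rewrite in_itv/= => yx.
    by rewrite /wt ltNge (le_trans (ltW yx) x0).
  rewrite radial_measure_ray// [X in la X](_ : _ = [set v | (sqnorm v < x)%R]).
    by rewrite lebesgue_ball// muleCA [in RHS]muleCA (muleC kappa).
  by apply/seteqP; split => v /=; rewrite in_itv.
move=> mC.
have : m1 C = m2 C.
  apply: (@measure_unique_rays R m1 m2) => // x; rewrite rayE m2E.
  have [x0|x0] := leP x 0%R.
    rewrite integral0_eq ?mule0 ?ltry// => y /=; rewrite in_itv/= => yx.
    by rewrite /wt ltNge (le_trans (ltW yx) x0).
  by rewrite radial_measure_ray// !lte_mul_pinfty// ?mule_ge0 ?lee_fin ?exprn_ge0 ?(ltW radial_mass_gt0)// radial_mass_lty.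
by rewrite m1E m2E.
Qed.

Lemma ge0_integral_sqnorm (G : R -> \bar R) : measurable_fun setT G ->
  (forall x, 0 <= G x) ->
  radial_mass * \int[la]_v G (sqnorm v) = kappa * \int[leb]_x ((wt x)%:E * G x).
Proof.
move=> mG G0.
have kappa0 : 0 <= kappa by exact: measure_ge0.
have rf : radial_mass \is a fin_num.
  by rewrite ge0_fin_numE ?radial_mass_lty// ltW// radial_mass_gt0.
have kf : kappa \is a fin_num by rewrite ge0_fin_numE//; exact: lebesgue_ball_lty.
pose r := NngNum (fine_ge0 (ltW radial_mass_gt0)).
pose k := NngNum (fine_ge0 kappa0).
pose D := density_measure leb measurable_radial_weight radial_weight_ge0.
rewrite -[in LHS](fineK rf) -[kappa](fineK kf).
have -> : \int[leb]_x ((wt x)%:E * G x) = \int[D]_x G x.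
  by rewrite (@ge0_integral_density _ _ _ leb wt measurable_radial_weight radial_weight_ge0 D).
have mGs : measurable_fun setT (fun v : 'cV[R]_n.+2 => G (sqnorm v)).
  by apply: measurableT_comp => //; exact: measurable_sqnorm.
transitivity (\int[mscale r la]_v G (sqnorm v)); first by rewrite ge0_integral_mscale.
transitivity (\int[mscale k D]_x G x); last by rewrite ge0_integral_mscale.
apply: (@eq_integral_law _ _ _ _ _ (mscale r la) _ _ (mscale k D) (@sqnorm R n.+2) id G) => //.
  exact: measurable_sqnorm.
move=> B mB; have := sqnorm_law mB.
by rewrite -{1}(fineK rf) -{1}(fineK kf).
Qed.

End radial_law.

(** * Polar coordinates in the half-plane *)

Section polar_coordinates.
Local Open Scope ereal_scope.
Variables (R : realType) (n : nat).
Notation leb := (@lebesgue_measure R).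
Local Notation wt := (@radial_weight R).

(** The point (x, sqrt t) of the half-plane has squared radius w = x^2 + t.  For
fixed x the substitution of w for t is a translation, and for fixed w the
substitution x = sqrt w * g is a dilation, so translations and dilations of the
line replace a two-dimensional change of variables. *)
Lemma polar_coordinates (f : R * R -> \bar R) : measurable_fun setT f ->
  (forall p, 0 <= f p) ->
  \int[leb]_x \int[leb]_t ((wt n t * (x ^+ 2 + t < 1)%R%:R)%:E *
    f (x / Num.sqrt (x ^+ 2 + t), Num.sqrt t / Num.sqrt (x ^+ 2 + t))%R) =
  @radial_mass R n.+1 *
    \int[leb]_g ((wt n (1 - g ^+ 2))%:E * f (g, Num.sqrt (1 - g ^+ 2))%R).
Proof.
move=> mf f0.
(* the integrand in the variables (x, w) *)
pose H (p : R * R) : \bar R := ((wt n (p.2 - p.1 ^+ 2) * (p.2 < 1)%R%:R)%:E *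
  f (p.1 / Num.sqrt p.2, Num.sqrt (p.2 - p.1 ^+ 2) / Num.sqrt p.2)%R).
have mdiff : measurable_fun setT (fun p : R * R => (p.2 - p.1 ^+ 2)%R).
  by apply: measurable_funB => //; exact: measurable_funX.
have mlt : measurable_fun setT (fun p : R * R => (p.2 < 1)%R%:R : R).
  have -> : (fun p : R * R => (p.2 < 1)%R%:R : R) = (fun p => if (p.2 < 1)%R then 1%R else 0%R).
    by apply/funext => p; case: ifP.
  apply: measurable_fun_ifT; try exact: measurable_cst.
  by apply: measurable_fun_ltr => //; exact: measurable_cst.
have msq : measurable_fun setT (fun p : R * R => (Num.sqrt p.2)^-1%R).
  apply: measurableT_comp; first exact: measurable_invr.
  by apply: measurableT_comp => //; exact: measurable_sqrtr.
have mH : measurable_fun setT H.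
  apply: emeasurable_funM.
    apply/measurable_EFinP; apply: measurable_funM => //.
    by apply: measurableT_comp => //; exact: measurable_radial_weight.
  apply: measurableT_comp => //; apply: measurable_fun_pair; first exact: measurable_funM.
  apply: measurable_funM => //.
  by apply: measurableT_comp => //; exact: measurable_sqrtr.
have H0 p : 0 <= H p.
  by rewrite mule_ge0// lee_fin mulr_ge0// radial_weight_ge0.
transitivity (\int[leb]_x \int[leb]_w H (x, w)).
  apply: eq_integral => x _.
  rewrite -[RHS](ge0_integral_translate (x ^+ 2)); last 2 first.
  - exact: (measurableT_comp mH (pair1_measurable x)).
  - by [].
  by apply: eq_integral => t _; rewrite /H /= addrAC subrr add0r.
transitivity (\int[leb]_w \int[leb]_x H (x, w)); first exact: (@fubini_tonelli _ _ _ _ R leb leb H mH H0).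
set J := \int[leb]_g ((wt n (1 - g ^+ 2))%:E * f (g, Num.sqrt (1 - g ^+ 2))%R).
have J0 : 0 <= J.
  by apply: integral_ge0 => g _; rewrite mule_ge0// lee_fin radial_weight_ge0.
transitivity (\int[leb]_w ((wt n.+1 w * (w < 1)%R%:R)%:E * J)); last first.
  rewrite ge0_integralZr//; first exact: measurable_radial_integrand.
  by move=> w _; rewrite lee_fin mulr_ge0// radial_weight_ge0.
apply: eq_integral => w _; have [w0|w0] := leP w 0%R.
  rewrite [in RHS]/radial_weight ltNge w0 mul0r mul0e integral0_eq// => x _.
  by rewrite /H /radial_weight /= ltNge subr_le0 (le_trans w0) ?sqr_ge0// mul0r mul0e.
have sw0 : (0 < Num.sqrt w)%R by rewrite sqrtr_gt0.
have mHw : measurable_fun setT (fun x => H (x, w)).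
  exact: (measurableT_comp mH (pair2_measurable w)).
rewrite -(ge0_integral_dilate sw0 mHw)//.
have HE g : H (Num.sqrt w * g, w)%R = (Num.sqrt w ^+ n * (w < 1)%R%:R)%:E *
    ((wt n (1 - g ^+ 2))%:E * f (g, Num.sqrt (1 - g ^+ 2))%R).
  rewrite /H /= exprMn sqr_sqrtr ?ltW//.
  have -> : (w - w * g ^+ 2 = w * (1 - g ^+ 2))%R by ring.
  rewrite radial_weightM// sqrtrM ?ltW// ![(Num.sqrt w * _)%R]mulrC !mulfK ?gt_eqF//.
  by rewrite muleA -EFinM; congr (_%:E * _); ring.
under eq_integral do rewrite HE.
rewrite ge0_integralZl//; last 2 first.
- apply: emeasurable_funM.
    apply/measurable_EFinP; apply: measurableT_comp; first exact: measurable_radial_weight.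
    by apply: measurable_funB => //; exact: measurable_funX.
  apply: measurableT_comp => //; apply: measurable_fun_pair => //.
  apply: measurableT_comp; first exact: measurable_sqrtr.
  by apply: measurable_funB => //; exact: measurable_funX.
- by move=> g _; rewrite mule_ge0// lee_fin radial_weight_ge0.
by rewrite muleA -EFinM mulrA -exprS /radial_weight w0.
Qed.

End polar_coordinates.

(** * The measure of a cone over a set of directions *)

Section cone_measure.
Local Open Scope ereal_scope.
Variables (R : realType) (n : nat).
Notation leb := (@lebesgue_measure R).
Local Notation wt := (@radial_weight R n).
Let e1 : 'cV[R]_n.+2 := (delta_mx 0 0)%R.

Variable la : {sigma_finite_measure set 'cV[R]_n.+2 -> \bar R}.
Hypothesis laL : is_lebesgue la.
Variable h : probability 'M[R]_n.+2 R.
Hypothesis hh : haar_distribution h.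

(** The points of the unit ball whose direction is in A.  At the origin the
direction is 0; this convention is compatible with orthogonal maps. *)
Definition cone (A : set 'cV[R]_(1 + n.+2)) : set 'cV[R]_(1 + n.+2) :=
  [set z | (sqnorm z < 1)%R /\ A ((Num.sqrt (sqnorm z))^-1 *: z)%R].

Lemma measurable_cone A : measurable A -> measurable (cone A).
Proof.
move=> mA; apply: measurableI; first exact: measurable_sqnorm_lt.
rewrite -[X in measurable X]setTI.
apply: (_ : measurable_fun setT (fun z : 'cV[R]_(1 + n.+2) => (Num.sqrt (sqnorm z))^-1 *: z)%R) => //.
apply: measurable_scalemx => //.
apply: measurableT_comp; first exact: measurable_invr.
by apply: measurableT_comp; [exact: measurable_sqrtr|exact: measurable_sqnorm].
Qed.

(** The probability that (c, s U) is in A for p = (c, s) and U uniform on the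
sphere, where U is represented as the first column of a Haar matrix. *)
Definition column_prob (A : set 'cV[R]_(1 + n.+2)) (p : R * R) : \bar R :=
  h [set Q | A (cons_col (p.1, p.2 *: (Q *m e1)))%R].

Variable A : set 'cV[R]_(1 + n.+2).
Hypothesis mA : measurable A.

Lemma measurable_column_set :
  measurable [set q : (R * R) * 'M[R]_n.+2 | A (cons_col (q.1.1, q.1.2 *: (q.2 *m e1)))%R].
Proof.
rewrite -[X in measurable X]setTI.
apply: (_ : measurable_fun setT (fun q : (R * R) * 'M[R]_n.+2 =>
   cons_col (q.1.1, q.1.2 *: (q.2 *m e1)))%R) => //.
apply: (measurableT_comp (@measurable_cons_col R n.+2)).
apply: measurable_fun_pair; first exact: measurableT_comp.
apply: measurable_scalemx; first exact: measurableT_comp.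
by apply: measurable_mulmx => //; exact: measurable_cst.
Qed.

Lemma measurable_column_prob : measurable_fun setT (column_prob A).
Proof. exact: (measurable_slice1 h measurable_column_set). Qed.

Lemma column_prob_ge0 p : 0 <= column_prob A p.
Proof. exact: measure_ge0. Qed.

(** A vector v is the image of |v| e1 by an orthogonal matrix, which is absorbed on
the right of the Haar matrix. *)
Lemma haar_column (x c : R) (v : 'cV[R]_n.+2) :
  h [set Q | A (c *: cons_col (x, Q *m v))%R] =
  column_prob A (c * x, c * Num.sqrt (sqnorm v))%R.
Proof.
pose Q0 := householder (Num.sqrt (sqnorm v) *: e1)%R v.
have vE : v = Q0 *m (Num.sqrt (sqnorm v) *: e1)%R.
  rewrite householder_mul// sqnormZ sqr_sqrtr ?sqnorm_ge0//.
  by rewrite sqnorm_delta mulr1.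
have mAc : measurable [set Q : 'M[R]_n.+2 |
    A (cons_col (c * x, (c * Num.sqrt (sqnorm v)) *: (Q *m e1)))%R].
  by have := measurable_xsection (c * x, c * Num.sqrt (sqnorm v))%R measurable_column_set;
    rewrite xsection_set.
rewrite /column_prob /= -(hh.2 Q0 (orthogonal_householder _ _) _ mAc).2.
have QvE Q : Q *m v = (Num.sqrt (sqnorm v) *: (Q *m Q0 *m e1))%R.
  by rewrite {1}vE -[Q0 *m _]scalemxAr -scalemxAr mulmxA.
by congr (h _); apply/seteqP; split => Q /=;
  rewrite QvE /cons_col/= scale_col_mx scalerA scale_scalar_mx.
Qed.

Definition radial_slice (x t : R) : \bar R := ((x ^+ 2 + t < 1)%R%:R)%:E *
  column_prob A (x / Num.sqrt (x ^+ 2 + t), Num.sqrt t / Num.sqrt (x ^+ 2 + t))%R.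

(** By orthogonal invariance of la, v may be replaced by Q v for every orthogonal
Q; averaging over a Haar matrix Q makes the direction of v uniform and leaves
only its norm. *)
Lemma cone_slice (x : R) :
  la [set v | cone A (cons_col (x, v))] = \int[la]_v radial_slice x (sqnorm v).
Proof.
pose C : set ('M[R]_n.+2 * 'cV[R]_n.+2) := [set q | (x ^+ 2 + sqnorm q.2 < 1)%R /\
  A ((Num.sqrt (x ^+ 2 + sqnorm q.2))^-1 *: cons_col (x, q.1 *m q.2))%R].
have msn : measurable_fun setT (fun q : 'M[R]_n.+2 * 'cV[R]_n.+2 => x ^+ 2 + sqnorm q.2)%R.
  apply: measurable_funD; first exact: measurable_cst.
  by apply: measurableT_comp => //; exact: measurable_sqnorm.
have mC1 : measurable [set q : 'M[R]_n.+2 * 'cV[R]_n.+2 | (x ^+ 2 + sqnorm q.2 < 1)%R].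
  rewrite (_ : [set _ | _] = (fun q : 'M[R]_n.+2 * 'cV[R]_n.+2 => x ^+ 2 + sqnorm q.2)%R @^-1` `]-oo, 1%R[%classic).
    by rewrite -[X in measurable X]setTI; exact: msn.
  by apply/seteqP; split => q /=; rewrite in_itv.
have mC2 : measurable [set q : 'M[R]_n.+2 * 'cV[R]_n.+2 |
    A ((Num.sqrt (x ^+ 2 + sqnorm q.2))^-1 *: cons_col (x, q.1 *m q.2))%R].
  rewrite -[X in measurable X]setTI.
  apply: (_ : measurable_fun setT (fun q : 'M[R]_n.+2 * 'cV[R]_n.+2 =>
    (Num.sqrt (x ^+ 2 + sqnorm q.2))^-1 *: cons_col (x, q.1 *m q.2))%R) => //.
  apply: measurable_scalemx.
    apply: measurableT_comp; first exact: measurable_invr.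
    by apply: measurableT_comp => //; exact: measurable_sqrtr.
  apply: (measurableT_comp (@measurable_cons_col R n.+2)).
  by apply: measurable_fun_pair; [exact: measurable_cst|exact: measurable_mulmx].
have mC : measurable C by exact: (measurableI _ _ mC1 mC2).
have mE : measurable [set v | cone A (cons_col (x, v))].
  have : measurable_fun setT (fun v => @cons_col R n.+2 (x, v)).
    by apply: (measurableT_comp (@measurable_cons_col R n.+2)); exact: pair1_measurable.
  by move=> /(_ measurableT _ (measurable_cone mA)); rewrite setTI.
rewrite -(@integral_full_cst _ _ _ h (@orthogonal_group R n.+2)
   (fun Q => la [set v | C (Q, v)]) (la [set v | cone A (cons_col (x, v))])); first last.
- move=> Q oQ; rewrite -(lebesgue_orthogonal laL oQ mE).
  congr (la _); apply/seteqP; split => v /=;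
  by rewrite /C /cone/= sqnorm_col_mx sqnorm_orthogonal.
- exact: measurable_slice1.
- exact: hh.1.
- exact: measurable_orthogonal_group.
rewrite (section_swap h la mC); apply: eq_integral => v _.
rewrite /radial_slice; case: (boolP (x ^+ 2 + sqnorm v < 1)%R) => xv.
  rewrite mul1e [(x / _)%R]mulrC [(Num.sqrt (sqnorm v) / _)%R]mulrC -haar_column.
  by congr (h _); apply/seteqP; split => Q /=; [case|split].
rewrite mul0e -(measure0 h); by congr (h _); apply/seteqP; split => Q //=; case; rewrite (negbTE xv).
Qed.

Let lap := pushforward (leb \x la) (@cons_col R n.+2).
Let kappa := la [set v | (sqnorm v < 1)%R].

Lemma measurable_radial_slice :
  measurable_fun setT (fun p : R * R => radial_slice p.1 p.2).
Proof.
have msn : measurable_fun setT (fun p : R * R => p.1 ^+ 2 + p.2)%R.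
  by apply: measurable_funD => //; exact: measurable_funX.
have msq : measurable_fun setT (fun p : R * R => (Num.sqrt (p.1 ^+ 2 + p.2))^-1%R).
  apply: measurableT_comp; first exact: measurable_invr.
  by apply: measurableT_comp => //; exact: measurable_sqrtr.
apply: emeasurable_funM.
  apply/measurable_EFinP.
  have -> : (fun p : R * R => (p.1 ^+ 2 + p.2 < 1)%R%:R : R) =
      (fun p => if (p.1 ^+ 2 + p.2 < 1)%R then 1%R else 0%R).
    by apply/funext => p; case: ifP.
  apply: measurable_fun_ifT; try exact: measurable_cst.
  by apply: measurable_fun_ltr => //; exact: measurable_cst.
apply: (measurableT_comp measurable_column_prob); apply: measurable_fun_pair.
  exact: measurable_funM.
apply: measurable_funM => //.
by apply: measurableT_comp => //; exact: measurable_sqrtr.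
Qed.

Lemma radial_slice_ge0 x t : 0 <= radial_slice x t.
Proof. by rewrite mule_ge0 ?column_prob_ge0// lee_fin. Qed.

Lemma cone_measure :
  @radial_mass R n * lap (cone A) = kappa * (@radial_mass R n.+1 *
    \int[leb]_g ((wt (1 - g ^+ 2))%:E * column_prob A (g, Num.sqrt (1 - g ^+ 2))%R)).
Proof.
have mcA : measurable (@cons_col R n.+2 @^-1` cone A).
  by rewrite -[X in measurable X]setTI; apply: measurable_cons_col => //; exact: measurable_cone.
have mxs x : measurable_fun setT (radial_slice x).
  exact: (measurableT_comp measurable_radial_slice (pair1_measurable x)).
have kappa0 : 0 <= kappa by exact: measure_ge0.
pose F (p : R * R) := (wt p.2)%:E * radial_slice p.1 p.2.
have mF : measurable_fun setT F.
  apply: emeasurable_funM; last exact: measurable_radial_slice.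
  apply/measurable_EFinP; apply: measurableT_comp => //.
  exact: measurable_radial_weight.
have F0 p : 0 <= F p.
  by rewrite mule_ge0 ?radial_slice_ge0// lee_fin radial_weight_ge0.
rewrite -(polar_coordinates n measurable_column_prob column_prob_ge0).
transitivity (kappa * \int[leb]_x \int[leb]_t F (x, t)); last first.
  congr (_ * _); apply: eq_integral => x _; apply: eq_integral => t _.
  by rewrite /F /radial_slice /= muleA EFinM.
rewrite /lap /pushforward product_measure1_set -ge0_integralZl//; last 2 first.
- exact: (measurable_slice1 la mcA).
- exact: ltW (radial_mass_gt0 _).
rewrite -ge0_integralZl//; last 2 first.
- exact: (@measurable_fun_fubini_tonelli_F _ _ _ _ R leb F mF F0).
- by move=> x _; apply: integral_ge0 => t _.
apply: eq_integral => x _ /=.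
by rewrite [X in _ * X]cone_slice (ge0_integral_sqnorm laL (mxs x) (radial_slice_ge0 x)).
Qed.

End cone_measure.

(** * Haar-distributed random matrices *)

Section full_sets.
Local Open Scope ereal_scope.
Context d (T : measurableType d) (R : realType) (P : probability T R).

Lemma probability_setI1 (E F : set T) : measurable E -> measurable F ->
  P E = 1 -> P F = 1 -> P (E `&` F) = 1.
Proof.
move=> mE mF PE PF; have mEF := measurableI _ _ mE mF.
apply/eqP; rewrite eq_le probability_le1//= -PE.
have PEF : P (E `\` F) = 0.
  apply/eqP; rewrite eq_le measure_ge0 andbT.
  have <- : P (~` F) = 0 by rewrite [LHS](probability_setC P mF) PF subee.
  apply: le_measure; rewrite ?inE; [exact: measurableD|exact: measurableC|].
  by move=> t [].
by rewrite (measureDI P mE mF) [X in X + _]PEF add0e.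
Qed.

Lemma probability_eq_full (D E F : set T) : measurable D -> measurable E ->
  measurable F -> P D = 1 -> (forall t, D t -> E t <-> F t) -> P E = P F.
Proof.
move=> mD mE mF PD EF.
have PI A : measurable A -> P A = P (A `&` D).
  move=> mA; have PAD : P (A `\` D) = 0.
    apply/eqP; rewrite eq_le measure_ge0 andbT.
    have <- : P (~` D) = 0 by rewrite [LHS](probability_setC P mD) PD subee.
    apply: le_measure; rewrite ?inE; [exact: measurableD|exact: measurableC|].
    by move=> t [].
  by rewrite (measureDI P mA mD) [X in X + _]PAD add0e.
rewrite (PI E)// (PI F)//; congr (P _).
by apply/seteqP; split => t [At Dt]; split => //; apply/(EF t Dt).
Qed.

End full_sets.

Section uniform_haar.
Local Open Scope ereal_scope.
Variables (R : realType) (k : nat).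
Let e1 : 'cV[R]_k.+1 := (delta_mx 0 0)%R.

(** The uniform distribution is unique: average 1_B(Q x) over a Haar matrix Q and
a uniform x in both orders. *)
Lemma uniform_sphere_haar (u : probability 'cV[R]_k.+1 R)
    (h : probability 'M[R]_k.+1 R) :
  uniform_sphere u -> haar_distribution h ->
  forall B, measurable B -> u B = h [set Q | B (Q *m e1)].
Proof.
move=> [u1 uinv] [h1 hinv] B mB.
pose C : set ('M[R]_k.+1 * 'cV[R]_k.+1) := [set q | B (q.1 *m q.2)].
have mC : measurable C.
  rewrite -[C]setTI; apply: (_ : measurable_fun setT
    (fun q : 'M[R]_k.+1 * 'cV[R]_k.+1 => q.1 *m q.2)) => //.
  exact: measurable_mulmx.
have mS x : measurable [set Q : 'M[R]_k.+1 | B (Q *m x)].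
  by have := measurable_ysection x mC; rewrite ysection_set.
have := section_swap h u mC.
rewrite (@integral_full_cst _ _ _ h (@orthogonal_group R k.+1) _ (u B))//; first last.
- by move=> Q oQ; exact: (uinv Q oQ B mB).
- exact: measurable_slice1.
- exact: measurable_orthogonal_group.
move=> ->.
apply: (@integral_full_cst _ _ _ u (@unit_sphere R k.+1)) => //.
- exact: measurable_unit_sphere.
- have := @measurable_fun_ysection _ _ _ _ _ h _ mC.
  by apply: eq_measurable_fun => x _ /=; rewrite ysection_set.
move=> x /unit_sphereP x1.
rewrite /C /= -[RHS](hinv _ (orthogonal_householder e1 x) _ (mS e1)).2.
congr (h _); apply/seteqP; split => Q /=;
by rewrite -mulmxA householder_mul// sqnorm_delta.
Qed.

End uniform_haar.

Section haar_rv.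
Local Open Scope ereal_scope.
Context d (T : measurableType d) (R : realType) (P : probability T R).

Lemma haar_trmx k (D DT : {RV P >-> 'M[R]_k}) : (forall t, DT t = (D t)^T) ->
  haar_distribution (distribution P D) -> haar_distribution (distribution P DT).
Proof.
move=> DTE [D1 Dinv]; split.
  rewrite -D1 /distribution /pushforward; congr (P _).
  apply/seteqP; split => t /=; rewrite DTE => oD.
    by rewrite -[D t]trmxK; exact: orthogonal_trmx.
  exact: orthogonal_trmx.
have mT (B : set 'M[R]_k) : measurable B -> measurable [set A : 'M[R]_k | B A^T].
  move=> mB; rewrite -[X in measurable X]setTI.
  apply: (_ : measurable_fun setT (fun p : 'M[R]_k => p^T)) => //.
  exact: measurable_trmx.
have DTB (B : set 'M[R]_k) : distribution P DT B = distribution P D [set A | B A^T].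
  by rewrite /distribution /pushforward; congr (P _); apply/seteqP; split => t /=; rewrite DTE.
move=> Q oQ B mB.
have [dl dr] := Dinv Q^T (orthogonal_trmx oQ) _ (mT B mB).
split; rewrite [LHS]DTB [RHS]DTB; [rewrite -[RHS]dr|rewrite -[RHS]dl]; congr (distribution P D _);
  by apply/seteqP; split => A /=; rewrite trmx_mul trmxK.
Qed.

(** The form of the extension principle for independent random variables, up to
a null event. *)
Lemma haar_extension k d' (W : measurableType d') (w : {RV P >-> W})
    (psi : {RV P >-> 'M[R]_k}) (M : W -> 'M[R]_(1 + k)) (D : set W)
    (G : {RV P >-> 'M[R]_(1 + k)}) (E : set T) :
  (forall A B, measurable A -> measurable B ->
    P (w @^-1` A `&` psi @^-1` B) = P (w @^-1` A) * P (psi @^-1` B)) ->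
  measurable_fun setT M -> measurable D -> P (w @^-1` D) = 1 ->
  (forall x, D x -> orthogonal_group (M x)) ->
  (forall Q : 'M[R]_(1 + k), orthogonal_group Q -> forall B, measurable B ->
    P [set t | B (Q *m (M (w t) *m delta_mx 0%R 0%R : 'cV[R]_(1 + k)))] =
    P [set t | B (M (w t) *m delta_mx 0%R 0%R : 'cV[R]_(1 + k))]) ->
  haar_distribution (distribution P psi) ->
  measurable E -> P E = 1 ->
  (forall t, E t -> G t = M (w t) *m stab_mx (psi t)) ->
  haar_distribution (distribution P G).
Proof.
move=> wpsi mM mD wD oM Me1 hpsi mE PE GE.
have mMs : measurable_fun setT (fun p : W * 'M[R]_k => M p.1 *m stab_mx p.2).
  apply: measurable_mulmx; first exact: measurableT_comp.
  by apply: (@measurable_block_mx _ _ _ 1 k 1 k) => //; exact: measurable_cst.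
have law (Q : 'M[R]_(1 + k)) B : measurable B ->
    P [set t | B (Q *m G t)] =
    (distribution P w \x distribution P psi) [set p | B (Q *m (M p.1 *m stab_mx p.2))].
  move=> mB.
  have mC : measurable [set p : W * 'M[R]_k | B (Q *m (M p.1 *m stab_mx p.2))].
    rewrite -[X in measurable X]setTI; apply: (_ : measurable_fun setT
      (fun p : W * 'M[R]_k => Q *m (M p.1 *m stab_mx p.2))) => //.
    by apply: measurable_mulmx => //; exact: measurable_cst.
  rewrite -(independent_pair_law wpsi mC) /=.
  apply: (probability_eq_full mE) => //; last by move=> t Et /=; rewrite GE.
    rewrite -[X in measurable X]setTI; apply: (_ : measurable_fun setT
      (fun t => Q *m G t)) => //.
    by apply: measurable_mulmx => //; exact: measurable_cst.
  rewrite -[X in measurable X]setTI; apply: (_ : measurable_fun setT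
      (fun t => Q *m (M (w t) *m stab_mx (psi t)))) => //.
  apply: measurable_mulmx; first exact: measurable_cst.
  exact: (measurableT_comp mMs (measurable_fun_pair _ _)).
have mO := @measurable_orthogonal_group R.
apply: left_invariant_haar.
  have mw : measurable (w @^-1` D) by rewrite -[X in measurable X]setTI; exact: measurable_funP.
  have mpsi : measurable (psi @^-1` @orthogonal_group R k).
    by rewrite -[X in measurable X]setTI; exact: measurable_funP.
  apply/eqP; rewrite eq_le probability_le1/=; last exact: mO.
  rewrite -(probability_setI1 mE (measurableI _ _ mw mpsi) PE (probability_setI1 mw mpsi wD hpsi.1)).
  change (P (E `&` (w @^-1` D `&` psi @^-1` @orthogonal_group R k)) <=
    P (G @^-1` @orthogonal_group R (1 + k))).
  apply: le_measure; rewrite ?inE.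
  - exact: (measurableI _ _ mE (measurableI _ _ mw mpsi)).
  - by rewrite -[X in measurable X]setTI; apply: measurable_funP => //; exact: mO.
  move=> t [Et [Dt ot]]; rewrite /preimage/= GE//.
  by apply: orthogonal_mulmx; [exact: oM|exact: orthogonal_stab_mx].
move=> Q oQ B mB.
transitivity ((distribution P w \x distribution P psi) [set p | B (Q *m (M p.1 *m stab_mx p.2))]).
  exact: law.
transitivity ((distribution P w \x distribution P psi) [set p | B (M p.1 *m stab_mx p.2)]).
  exact: (@left_invariant_extension _ _ _ _ (distribution P w) D M (distribution P psi)).
rewrite [RHS](_ : _ = P [set t | B (1%:M *m G t)]).
  by rewrite (law 1%:M B mB); congr (product_measure1 _ _ _); apply/seteqP; split => p /=; rewrite mul1mx.
by congr (P _); apply/seteqP; split => t /=; rewrite mul1mx.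
Qed.

End haar_rv.

(** * From four independent variables to two independent pairs *)

Section independence4.
Local Open Scope ereal_scope.
Context d (T : measurableType d) (R : realType) (P : probability T R).

(** The product formula for the full family of four events; a smaller family is
obtained by taking the whole space for some of the sets. *)
Lemma independent4_rectangles d1 (T1 : measurableType d1) d2 (T2 : measurableType d2)
    d3 (T3 : measurableType d3) d4 (T4 : measurableType d4)
    (X1 : T -> T1) (X2 : T -> T2) (X3 : T -> T3) (X4 : T -> T4) A1 A2 A3 A4 :
  independent4 P X1 X2 X3 X4 ->
  measurable A1 -> measurable A2 -> measurable A3 -> measurable A4 ->
  P ((X1 @^-1` A1 `&` X2 @^-1` A2) `&` (X3 @^-1` A3 `&` X4 @^-1` A4)) =
  P (X1 @^-1` A1) * P (X2 @^-1` A2) * (P (X3 @^-1` A3) * P (X4 @^-1` A4)).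
Proof.
move=> ind m1 m2 m3 m4.
pose E := tnth [tuple X1 @^-1` A1; X2 @^-1` A2; X3 @^-1` A3; X4 @^-1` A4].
have := ind [set: 'I_4]%SET E.
rewrite (eq_bigl xpredT); last by move=> i; rewrite finset.in_setT.
rewrite !big_ord_recl big_ord0 mule1 !muleA /E => <-; first last.
  move=> i _; move: i; case=> -[|[|[|[|//]]]] i4; rewrite /sigma_of /tnth/=.
  - by exists A1 => //; rewrite setTI.
  - by exists A2 => //; rewrite setTI.
  - by exists A3 => //; rewrite setTI.
  - by exists A4 => //; rewrite setTI.
congr (P _); apply/seteqP; split=> [t [[t1 t2] [t3 t4]]|t tE].
  by case=> -[|[|[|[|//]]]] i4 _.
have tI (i : 'I_4) : tnth [tuple X1 @^-1` A1; X2 @^-1` A2; X3 @^-1` A3; X4 @^-1` A4] i t.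
  by apply: tE; rewrite /= finset.in_setT.
split; split.
- exact: (tI (@Ordinal 4 0 isT)).
- exact: (tI (@Ordinal 4 1 isT)).
- exact: (tI (@Ordinal 4 2 isT)).
- exact: (tI (@Ordinal 4 3 isT)).
Qed.

Definition random_variable_of d' (T' : measurableType d') (f : T -> T')
  (mf : measurable_fun setT f) : {RV P >-> T'} :=
  HB.pack f (isMeasurableFun.Build _ _ _ _ _ mf).

(** Independence of an event from the pair (X1, X2) needs to be checked on
rectangles only. *)
Lemma independent_event d1 (T1 : measurableType d1) d2 (T2 : measurableType d2)
    (X1 : {RV P >-> T1}) (X2 : {RV P >-> T2}) (E : set T) : measurable E ->
  (forall A1 A2, measurable A1 -> measurable A2 ->
    P ((X1 @^-1` A1 `&` X2 @^-1` A2) `&` E) = P (X1 @^-1` A1 `&` X2 @^-1` A2) * P E) ->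
  forall C : set (T1 * T2), measurable C ->
    P ([set t | C (X1 t, X2 t)] `&` E) = P [set t | C (X1 t, X2 t)] * P E.
Proof.
move=> mE ind C mC.
have mX : measurable_fun setT (fun t => (X1 t, X2 t)).
  by apply: measurable_fun_pair; exact: measurable_funP.
pose k := NngNum (fine_ge0 (measure_ge0 P E)).
pose m1 := image_measure (mrestr P mE) mX.
pose m2 := mscale k (image_measure P mX).
have m1E A : m1 A = P ([set t | A (X1 t, X2 t)] `&` E) by [].
have m2E A : m2 A = P E * P [set t | A (X1 t, X2 t)].
  by rewrite -[X in X * _](fineK (fin_num_measure P E mE)).
rewrite muleC -m1E -m2E.
pose G : set (set (T1 * T2)) :=
  [set C | exists A, measurable A /\ exists B, measurable B /\ C = A `*` B].
apply: (@measure_unique _ R _ G (fun _ => setT)) => //.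
- rewrite measurable_prod_measurableType; congr (<<s _ >>).
  rewrite predeqE; split => [[A mA' [B mB <-]]|[A [mA' [B [mB ->]]]]].
    by exists A; split => //; exists B.
  by exists A => //; exists B.
- move=> _ _ [Y1 [mY1 [Y2 [mY2 ->]]]] [Z1 [mZ1 [Z2 [mZ2 ->]]]].
  rewrite -setXI; exists (Y1 `&` Z1); split; first exact: measurableI.
  by exists (Y2 `&` Z2); split => //; exact: measurableI.
- move=> _; exists setT; split => //; exists setT; split => //.
  by rewrite setXTT.
- by rewrite bigcup_const.
- move=> _ [A [mA' [B [mB ->]]]].
  transitivity (P E * P (X1 @^-1` A `&` X2 @^-1` B)); last by [].
  by rewrite muleC -ind.
- move=> _; rewrite m1E; apply: (@le_lt_trans _ _ 1); last exact: ltry.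
  by apply: probability_le1; rewrite setTI.
Qed.

End independence4.

(** * The density of the corner entry *)

Section corner.
Variables (R : realType) (n : nat).

Definition corner_constant : R :=
  gamma_function (2^-1 * n.+3%:R) /
    (gamma_function 2^-1 * gamma_function (2^-1 * (n.+3%:R - 1))).

Lemma gamma_function_ge0 (a : R) : 0 <= gamma_function a.
Proof.
apply: fine_ge0; apply: integral_ge0 => t _.
by rewrite lee_fin mulr_ge0// ?powR_ge0// expR_ge0.
Qed.

Lemma corner_constant_ge0 : 0 <= corner_constant.
Proof. by rewrite divr_ge0 ?mulr_ge0// gamma_function_ge0. Qed.

Lemma corner_densityE (x : R) :
  corner_density n.+3 x = corner_constant * radial_weight n (1 - x ^+ 2).
Proof.
rewrite /corner_density /radial_weight subr_gt0.
have -> : (x ^+ 2 < 1) = (`|x| < 1).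
  by rewrite -[x ^+ 2]real_normK ?num_real// -{1}(expr1n R 2) ltr_pXn2r// nnegrE.
case: ifPn => x1; last by rewrite mulr0.
congr (_ * _).
have y0 : 0 <= 1 - x ^+ 2.
  by rewrite subr_ge0 -[x ^+ 2]real_normK ?num_real// expr_le1// ltW.
have -> : (n.+3%:R - 3) / 2 = 2^-1 * n%:R :> R.
  by rewrite -[n.+3]addn3 natrD; field.
by rewrite powRrM powR12_sqrt// powR_mulrn ?sqrtr_ge0.
Qed.

End corner.

(** * Factorization of the block matrix *)

Section block_factorization.
Variables (R : realType) (n : nat).
Let e1 : 'cV[R]_n.+2 := delta_mx 0 0.

(** The left factor M(g, u) of Gamma; it is Gamma itself for U_2 = e1 and
Delta = 1. *)
Definition corner_mx (g : R) (u : 'cV[R]_n.+2) : 'M[R]_(1 + n.+2) :=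
  Gamma g u e1 1%:M.

Let s (g : R) := Num.sqrt (1 - g ^+ 2).
Let refl (g : R) : 'M[R]_(1 + n.+1) := block_mx (- g)%:M 0 0 1%:M.

Lemma corner_sqrt_gt0 (g : R) : `|g| < 1 -> 0 < s g.
Proof.
move=> g1; rewrite sqrtr_gt0 subr_gt0.
by rewrite -[g ^+ 2]real_normK ?num_real// -(expr1n R 2) ltr_pXn2r// nnegrE.
Qed.

Lemma corner_mxE g u : `|g| < 1 ->
  corner_mx g u = block_mx g%:M (s g *: e1^T) (s g *: u) (householder e1 u *m refl g).
Proof.
move=> g1; rewrite /corner_mx /Gamma -/(s g) linearZ/= trmxK -/e1.
rewrite householderZ ?gt_eqF ?corner_sqrt_gt0//.
by rewrite /householder eqxx trmx1 mulmx1.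
Qed.

Let e1E : e1 = (col_mx 1%:M 0 : 'cV[R]_(1 + n.+1)). Proof. exact: (@delta_mx_col R n.+1). Qed.

Lemma refl_delta g : refl g *m e1 = - g *: e1.
Proof.
rewrite e1E /refl mul_block_col !mulmx0 !mul0mx !addr0 mulmx1.
by rewrite [RHS](@scale_col_mx _ 1 n.+1 1) scaler0 scale_scalar_mx mulr1.
Qed.

Lemma trmx_refl g : (refl g)^T = refl g.
Proof. by rewrite /refl tr_block_mx !tr_scalar_mx !trmx0. Qed.

Lemma corner_mx_delta g u : `|g| < 1 ->
  corner_mx g u *m (delta_mx 0 0 : 'cV[R]_(1 + n.+2)) = cons_col (g, s g *: u).
Proof.
move=> g1; rewrite corner_mxE// delta_mx_col mul_block_col !mulmx0 !mulmx1 !addr0.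
by [].
Qed.

(** Up to the left factor stab(H(e1, u)), the matrix is a reflection of the plane
of the first two coordinates. *)
Lemma orthogonal_corner_mx g u : `|g| < 1 -> unit_sphere u ->
  orthogonal_group (corner_mx g u).
Proof.
move=> g1 /unit_sphereP u1.
have s2 : s g ^+ 2 = 1 - g ^+ 2.
  rewrite sqr_sqrtr// subr_ge0 -[g ^+ 2]real_normK ?num_real// expr_le1// ltW//.
have he : householder e1 u *m e1 = u by rewrite householder_mul// sqnorm_delta.
have -> : corner_mx g u = stab_mx (householder e1 u) *m
    block_mx g%:M (s g *: e1^T) (s g *: e1) (refl g).
  rewrite corner_mxE// /stab_mx mulmx_block !mul1mx !mul0mx !addr0 !add0r.
  by rewrite -scalemxAr he.
apply: orthogonal_mulmx; first exact/orthogonal_stab_mx/orthogonal_householder.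
rewrite /orthogonal_group /= tr_block_mx tr_scalar_mx !linearZ/= trmxK trmx_refl.
rewrite mulmx_block -!scalemxAl -!scalemxAr !scalerA refl_delta.
have e1R : e1^T *m refl g = - g *: e1^T.
  by rewrite -[RHS]linearZ/= -refl_delta trmx_mul trmx_refl.
rewrite e1R sqnorm_mul_trmx sqnorm_delta -expr2 s2 [RHS](@scalar_mx_block _ 1 n.+2).
congr block_mx.
- by rewrite -scalar_mxM scale_scalar_mx mulr1 -raddfD -expr2 addrC subrK.
- by rewrite mul_scalar_mx !scalerA -scalerDl (_ : _ + _ = 0) ?scale0r//; ring.
- by rewrite mul_mx_scalar !scalerA -scalerDl (_ : _ + _ = 0) ?scale0r//; ring.
have -> : e1 *m e1^T = block_mx 1%:M 0 0 0 :> 'M[R]_(1 + n.+1).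
  rewrite e1E (@tr_col_mx _ 1 n.+1 1) trmx1 trmx0 (@mul_col_row _ 1 n.+1 1 1 n.+1).
  by rewrite mulmx1 mulmx0 mul0mx mulmx0.
have -> : refl g *m refl g = block_mx (g ^+ 2)%:M 0 0 1%:M.
  rewrite /refl (@mulmx_block _ 1 n.+1 1 n.+1 1 n.+1) !mulmx0 !mul0mx !mulmx1.
  by rewrite !addr0 !add0r -scalar_mxM mulrNN expr2.
rewrite [X in X + _](@scale_block_mx _ 1 n.+1 1 n.+1) !scaler0.
rewrite [LHS](@add_block_mx _ 1 n.+1 1 n.+1) !addr0 !add0r.
rewrite [RHS](@scalar_mx_block _ 1 n.+1) scale_scalar_mx mulr1 -raddfD.
by rewrite subrK.
Qed.

Lemma Gamma_factor g u1 u2 delta : `|g| < 1 -> unit_sphere u2 ->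
  Gamma g u1 u2 delta =
  corner_mx g u1 *m stab_mx (stab_mx delta *m (householder e1 u2)^T).
Proof.
move=> g1 /unit_sphereP u21; rewrite corner_mxE// /Gamma -/(s g) linearZ/= trmxK -/e1.
rewrite !householderZ ?gt_eqF ?corner_sqrt_gt0//.
have he : householder e1 u2 *m e1 = u2 by rewrite householder_mul// sqnorm_delta.
have er : s g *: u2^T = s g *: e1^T *m (stab_mx delta *m (householder e1 u2)^T).
  rewrite -scalemxAl -{1}he trmx_mul mulmxA; congr (_ *: (_ *m _)).
  by rewrite -[stab_mx delta]trmxK trmx_stab_mx -trmx_mul stab_mx_delta.
have dr : householder e1 u1 *m (block_mx (- g)%:M 0 0 delta : 'M[R]_(1 + n.+1)) *m (householder e1 u2)^T =
    householder e1 u1 *m refl g *m (stab_mx delta *m (householder e1 u2)^T).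
  rewrite !mulmxA; congr (_ *m _); rewrite -mulmxA; congr (_ *m _).
  rewrite /refl /stab_mx (@mulmx_block _ 1 n.+1 1 n.+1 1 n.+1).
  by rewrite !mulmx0 !mul0mx !mulmx1 !mul1mx !addr0 !add0r.
rewrite [stab_mx (_ *m _)]/stab_mx [RHS](@mulmx_block _ 1 n.+2 1 n.+2 1 n.+2).
by rewrite !mulmx1 !mulmx0 !addr0 !add0r er dr.
Qed.

End block_factorization.

(** * Uniformity of the first column, and conclusion *)

Section first_column.
Local Open Scope ereal_scope.
Variables (R : realType) (n : nat).
Notation leb := (@lebesgue_measure R).

(** Both integrals are the measure of a cone up to the same constant, and the cone
over the preimage of A by Q is the preimage of the cone over A. *)
Lemma first_column_law (la : {sigma_finite_measure set 'cV[R]_n.+2 -> \bar R})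
    (h : probability 'M[R]_n.+2 R) :
  is_lebesgue la -> haar_distribution h ->
  forall (Q : 'M[R]_(1 + n.+2)) (A : set 'cV[R]_(1 + n.+2)),
  orthogonal_group Q -> measurable A ->
  \int[leb]_g ((radial_weight n (1 - g ^+ 2))%:E *
    column_prob h [set z | A (Q *m z)] (g, Num.sqrt (1 - g ^+ 2))%R) =
  \int[leb]_g ((radial_weight n (1 - g ^+ 2))%:E *
    column_prob h A (g, Num.sqrt (1 - g ^+ 2))%R).
Proof.
move=> laL hh Q A oQ mA.
have mQA : measurable [set z | A (Q *m z)].
  rewrite -[X in measurable X]setTI; apply: (_ : measurable_fun setT
    (fun z : 'cV[R]_(1 + n.+2) => Q *m z)) => //.
  by apply: measurable_mulmx => //; exact: measurable_cst.
have rm0 k : 0 < @radial_mass R k := radial_mass_gt0 k.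
have rmf k : @radial_mass R k \is a fin_num.
  by rewrite ge0_fin_numE ?radial_mass_lty// ltW.
apply: (mule_pinj (rmf n.+1) (rm0 _)).
have kappaf : la [set v | (sqnorm v < 1)%R] \is a fin_num.
  by rewrite ge0_fin_numE//; exact: lebesgue_ball_lty.
apply: (mule_pinj kappaf (lebesgue_ball_gt0 laL)).
rewrite -(cone_measure laL hh mQA) -(cone_measure laL hh mA); congr (_ * _).
have lapL := is_lebesgue_cons laL.
rewrite -[RHS](@lebesgue_orthogonal _ _ (sigma_finite_measure_of (is_lebesgue_sigma_finite lapL)) lapL Q _ oQ (measurable_cone mA)).
rewrite /sigma_finite_measure_of; congr (pushforward _ _ _).
by apply/seteqP; split => z; rewrite /cone/= sqnorm_orthogonal// scalemxAr.
Qed.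

End first_column.

Section ingredients.
Local Open Scope ereal_scope.
Context (R : realType) (n : nat) (d : measure_display) (T : measurableType d)
  (P : probability T R).
Variables (Gamma11 : {RV P >-> R}) (U1 U2 : {RV P >-> 'cV[R]_n.+2})
  (Delta : {RV P >-> 'M[R]_n.+1}).
Hypotheses (indep : independent4 P Gamma11 U1 U2 Delta)
  (Gamma11_density : has_density (distribution P Gamma11) (@corner_density R n.+3))
  (U1_unif : uniform_sphere (distribution P U1))
  (U2_unif : uniform_sphere (distribution P U2))
  (Delta_haar : haar_distribution (distribution P Delta)).
Let e1 : 'cV[R]_n.+2 := (delta_mx 0 0)%R.
Notation leb := (@lebesgue_measure R).

Let rv_measurable d' (T' : measurableType d') (X : {RV P >-> T'}) A :
  measurable A -> measurable (X @^-1` A).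
Proof. by move=> mA; rewrite -[X in measurable X]setTI; exact: measurable_funP. Qed.

Lemma measurable_corner_interval : measurable [set x : R | (`|x| < 1)%R].
Proof.
rewrite (_ : [set _ | _] = `](-1)%R, 1%R[%classic); first exact: measurable_itv.
by apply/seteqP; split => x /=; rewrite in_itv/= ltr_norml.
Qed.

Lemma Gamma11_lt1 : P (Gamma11 @^-1` [set x | (`|x| < 1)%R]) = 1.
Proof.
have mI := measurable_corner_interval.
have P0 : P (Gamma11 @^-1` (~` [set x | (`|x| < 1)%R])) = 0.
  rewrite [LHS](Gamma11_density (measurableC mI)) integral0_eq// => x /= /negP x1.
  by rewrite /corner_density (negbTE x1).
have := probability_setC P (rv_measurable Gamma11 (measurableC mI)).
by rewrite -preimage_setC setCK [X in _ = 1 - X]P0 sube0.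
Qed.

(** The extension principle applied to the transpose of Psi, with first column
U_2. *)
Lemma Psi_haar : exists2 Psi : {RV P >-> 'M[R]_n.+2},
  (forall t, Psi t = stab_mx (Delta t) *m (householder e1 (U2 t))^T) &
  haar_distribution (distribution P Psi).
Proof.
have mDT : measurable_fun setT (fun t => (Delta t)^T).
  by apply: measurable_trmx; exact: measurable_funP.
have mH : measurable_fun setT (householder e1).
  by apply: measurable_householder => //; exact: measurable_cst.
have mHU : measurable_fun setT (fun t => householder e1 (U2 t)).
  by apply: measurable_householder; [exact: measurable_cst|exact: measurable_funP].
have mstab (D : T -> 'M[R]_n.+1) : measurable_fun setT D ->
    measurable_fun setT (fun t => stab_mx (D t)).
  by move=> mD; apply: (@measurable_block_mx _ _ _ 1 n.+1 1 n.+1) => //; exact: measurable_cst.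
have mPsi : measurable_fun setT (fun t => stab_mx (Delta t) *m (householder e1 (U2 t))^T).
  apply: measurable_mulmx; first by apply: mstab; exact: measurable_funP.
  exact: measurable_trmx.
have mPsiT : measurable_fun setT (fun t => householder e1 (U2 t) *m stab_mx (Delta t)^T).
  by apply: measurable_mulmx => //; exact: mstab.
pose DeltaT := random_variable_of P mDT.
pose PsiT := random_variable_of P mPsiT.
exists (random_variable_of P mPsi) => //.
apply: (@haar_trmx _ _ _ P _ PsiT).
  by move=> t /=; rewrite trmx_mul trmx_stab_mx trmxK.
have hDT : haar_distribution (distribution P DeltaT).
  exact: (@haar_trmx _ _ _ P _ Delta).
apply: (@haar_extension _ _ _ P n.+1 _ _ U2 DeltaT (householder e1) setT PsiT setT) => //.
- move=> A B mA mB.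
  have mTB : measurable [set D : 'M[R]_n.+1 | B D^T].
    rewrite -[X in measurable X]setTI; apply: (_ : measurable_fun setT
      (fun D : 'M[R]_n.+1 => D^T)) => //.
    exact: measurable_trmx.
  have := independent4_rectangles indep measurableT measurableT mA mTB.
  by rewrite !preimage_setT !setTI !probability_setT mule1 mul1e.
- by rewrite preimage_setT probability_setT.
- by move=> x _; exact: orthogonal_householder.
- move=> Q oQ B mB.
  have mQ : measurable_fun setT (fun z : 'cV[R]_n.+2 => Q *m z).
    by apply: measurable_mulmx => //; exact: measurable_cst.
  have mHe : measurable_fun setT (fun z : 'cV[R]_n.+2 => householder e1 z *m e1).
    by apply: measurable_mulmx => //; exact: measurable_cst.
  have hE t : U2 t \in @unit_sphere R n.+2 -> householder e1 (U2 t) *m e1 = U2 t.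
    by move=> /set_mem/unit_sphereP u1; rewrite householder_mul// u1 sqnorm_delta.
  have mS := rv_measurable U2 (@measurable_unit_sphere R n.+2).
  have mB1 : measurable [set z | B (Q *m z)] by rewrite -[X in measurable X]setTI; exact: mQ.
  have mB2 (B' : set 'cV[R]_n.+2) : measurable B' -> measurable [set z | B' (householder e1 z *m e1)].
    by move=> mB'; rewrite -[X in measurable X]setTI; exact: mHe.
  transitivity (P [set t | B (Q *m U2 t)]).
    apply: (probability_eq_full mS).
    + exact: (rv_measurable U2 (mB2 _ mB1)).
    + exact: (rv_measurable U2 mB1).
    + exact: U2_unif.1.
    + by move=> t St /=; rewrite hE//; exact/mem_set.
  transitivity (P [set t | B (U2 t)]); first exact: (U2_unif.2 Q oQ B mB).
  apply: (probability_eq_full mS).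
  + exact: (rv_measurable U2 mB).
  + exact: (rv_measurable U2 (mB2 _ mB)).
  + exact: U2_unif.1.
  + by move=> t St /=; rewrite hE//; exact/mem_set.
- exact: probability_setT.
Qed.

(** The law of the first column of Gamma, obtained by conditioning on Gamma_11 and
replacing U_1 by the first column of a Haar matrix. *)
Lemma first_column_integral (h : probability 'M[R]_n.+2 R) (A : set 'cV[R]_(1 + n.+2)) :
  haar_distribution h -> measurable A ->
  P [set t | A (cons_col (Gamma11 t, Num.sqrt (1 - Gamma11 t ^+ 2) *: U1 t))%R] =
  (corner_constant R n)%:E * \int[leb]_g ((radial_weight n (1 - g ^+ 2))%:E *
    column_prob h A (g, Num.sqrt (1 - g ^+ 2))%R).
Proof.
move=> hh mA.
have mw : measurable_fun setT (fun g : R => radial_weight n (1 - g ^+ 2)).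
  apply: measurableT_comp; first exact: measurable_radial_weight.
  by apply: measurable_funB => //; exact: measurable_funX.
have ms : measurable_fun setT (fun g : R => Num.sqrt (1 - g ^+ 2)).
  apply: measurableT_comp; first exact: measurable_sqrtr.
  by apply: measurable_funB => //; exact: measurable_funX.
have mcp : measurable_fun setT (fun g : R => column_prob h A (g, Num.sqrt (1 - g ^+ 2))%R).
  apply: (measurableT_comp (measurable_column_prob h mA)).
  exact: measurable_fun_pair.
have mC : measurable [set p : R * 'cV[R]_n.+2 |
    A (cons_col (p.1, Num.sqrt (1 - p.1 ^+ 2) *: p.2))%R].
  rewrite -[X in measurable X]setTI; apply: (_ : measurable_fun setT
    (fun p : R * 'cV[R]_n.+2 => cons_col (p.1, Num.sqrt (1 - p.1 ^+ 2) *: p.2))%R) => //.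
  apply: (measurableT_comp (@measurable_cons_col R n.+2)).
  apply: measurable_fun_pair => //; apply: measurable_scalemx => //.
  exact: (measurableT_comp ms).
have ind2 A1 A2 : measurable A1 -> measurable A2 ->
    P (Gamma11 @^-1` A1 `&` U1 @^-1` A2) = P (Gamma11 @^-1` A1) * P (U1 @^-1` A2).
  move=> mA1 mA2; have := independent4_rectangles indep mA1 mA2 measurableT measurableT.
  by rewrite !preimage_setT !setIT !probability_setT !mule1.
rewrite (independent_pair_law ind2 mC) product_measure1_set /=.
transitivity (\int[distribution P Gamma11]_g column_prob h A (g, Num.sqrt (1 - g ^+ 2))%R).
  apply: eq_integral => /= g _.
  have mAg : measurable [set u | A (cons_col (g, Num.sqrt (1 - g ^+ 2) *: u))%R].
    by have := measurable_xsection (g : R) mC; rewrite xsection_set.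
  exact: (uniform_sphere_haar U1_unif hh mAg).
have mcd : measurable_fun setT (@corner_density R n.+3).
  have -> : @corner_density R n.+3 =
      (fun x => corner_constant R n * radial_weight n (1 - x ^+ 2))%R.
    by apply/funext => x; rewrite corner_densityE.
  by apply: measurable_funM => //; exact: measurable_cst.
have cd0 x : (0 <= @corner_density R n.+3 x)%R.
  by rewrite corner_densityE mulr_ge0 ?corner_constant_ge0// radial_weight_ge0.
pose law : {measure set (measurableTypeR R) -> \bar R} :=
  @image_measure _ _ _ (measurableTypeR R) R P Gamma11 (measurable_funP Gamma11).
transitivity (\int[law]_g column_prob h A (g, Num.sqrt (1 - g ^+ 2))%R).
  pose F (g : R) := column_prob h A (g, Num.sqrt (1 - g ^+ 2))%R.
  have F0 g : 0 <= F g by exact: column_prob_ge0.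
  transitivity (\int[P]_t F (Gamma11 t)); first exact: (@ge0_integral_distribution _ _ _ _ _ P Gamma11 F mcp F0).
  apply/esym; have := @ge0_integral_pushforward _ _ _ (measurableTypeR R) _ Gamma11
    (measurable_funP Gamma11) P setT F measurableT mcp (fun y _ => F0 y).
  by rewrite preimage_setT.
rewrite (@ge0_integral_density _ _ _ leb _ mcd cd0 law)//.
under eq_integral do rewrite corner_densityE EFinM -muleA.
rewrite ge0_integralZl//.
- by apply: emeasurable_funM => //; exact/measurable_EFinP.
- by move=> g _; rewrite mule_ge0 ?column_prob_ge0// lee_fin radial_weight_ge0.
- by rewrite lee_fin corner_constant_ge0.
Qed.

End ingredients.

Theorem mainTheorem3 (R : realType) (n : nat) (d : measure_display)
    (T : measurableType d) (P : probability T R)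
    (Gamma11 : {RV P >-> R}) (U1 U2 : {RV P >-> 'cV[R]_n.+2})
    (Delta : {RV P >-> 'M[R]_n.+1})
    (indep : independent4 P Gamma11 U1 U2 Delta)
    (Gamma11_density :
       has_density (distribution P Gamma11) (@corner_density R n.+3))
    (U1_unif : uniform_sphere (distribution P U1))
    (U2_unif : uniform_sphere (distribution P U2))
    (Delta_haar : haar_distribution (distribution P Delta)) :
  exists G : {RV P >-> 'M[R]_n.+3},
    (forall t, G t = Gamma (Gamma11 t) (U1 t) (U2 t) (Delta t)) /\
    haar_distribution (distribution P G).
Proof.
have [Psi PsiE Psi_haar] := Psi_haar indep U2_unif Delta_haar.
have mG : measurable_fun setT (fun t => Gamma (Gamma11 t) (U1 t) (U2 t) (Delta t)).
  by apply: measurable_Gamma; exact: measurable_funP.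
exists (random_variable_of P mG); split=> //.
have mW : measurable_fun setT (fun t => (Gamma11 t, U1 t)).
  by apply: measurable_fun_pair; exact: measurable_funP.
have rvm d' (T' : measurableType d') (X : {RV P >-> T'}) A :
  measurable A -> measurable (X @^-1` A).
  by move=> mA; rewrite -[X in measurable X]setTI; exact: measurable_funP.
have mg := rvm _ _ Gamma11 _ (@measurable_corner_interval R).
have m1 := rvm _ _ U1 _ (@measurable_unit_sphere R n.+2).
have m2 := rvm _ _ U2 _ (@measurable_unit_sphere R n.+2).
have Pg := Gamma11_lt1 Gamma11_density.
pose w := random_variable_of P mW.
pose M (p : R * 'cV[R]_n.+2) := corner_mx p.1 p.2.
pose E1 := Gamma11 @^-1` [set x | `|x| < 1] `&` U1 @^-1` @unit_sphere R n.+2.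
have mE1 : measurable E1 by exact: measurableI.
have PE1 : P E1 = 1%E by apply: probability_setI1 => //; exact: U1_unif.1.
have mM : measurable_fun setT M.
  by apply: (@measurable_Gamma _ _ _ n fst snd (cst (delta_mx 0 0)) (cst 1%:M)); [exact: measurable_fst|
    exact: measurable_snd|exact: measurable_cst|exact: measurable_cst].
apply: (@haar_extension _ _ _ P n.+2 _ _ w Psi M
  [set p | `|p.1| < 1 /\ unit_sphere p.2] _ (E1 `&` U2 @^-1` @unit_sphere R n.+2)) => //.
- move=> A B mA mB.
  have mPB : measurable [set q : 'cV[R]_n.+2 * 'M[R]_n.+1 |
      B (stab_mx q.2 *m (householder (delta_mx 0 0) q.1)^T)].
    rewrite -[X in measurable X]setTI; apply: (_ : measurable_fun setT
      (fun q : 'cV[R]_n.+2 * 'M[R]_n.+1 =>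
         stab_mx q.2 *m (householder (delta_mx 0 0) q.1)^T)) => //.
    apply: measurable_mulmx.
      by apply: (@measurable_block_mx _ _ _ 1 n.+1 1 n.+1) => //; exact: measurable_cst.
    apply: measurable_trmx; apply: measurable_householder; first exact: measurable_cst.
    exact: measurable_fst.
  have PsiB : Psi @^-1` B = [set t | B (stab_mx (Delta t) *m (householder (delta_mx 0 0) (U2 t))^T)].
    by apply/seteqP; split => t /=; rewrite PsiE.
  apply: (independent_event (X1 := Gamma11) (X2 := U1)) => //; first exact: rvm.
  move=> A1 A2 mA1 mA2; rewrite PsiB setIC muleC.
  apply: (independent_event (X1 := U2) (X2 := Delta) _ _ mPB).
    by apply: measurableI; exact: rvm.
  move=> A3 A4 mA3 mA4; rewrite setIC (independent4_rectangles indep)//.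
  have H1 := independent4_rectangles indep mA1 mA2 measurableT measurableT.
  have H2 := independent4_rectangles indep measurableT measurableT mA3 mA4.
  move: H1 H2; rewrite !preimage_setT !setIT !setTI !probability_setT !mule1 !mul1e => -> ->.
  by rewrite muleC.
- have mD1 : measurable (@fst R 'cV[R]_n.+2 @^-1` [set x | `|x| < 1]).
    by rewrite -[X in measurable X]setTI; apply: measurable_fst => //; exact: measurable_corner_interval.
  have mD2 : measurable (@snd R 'cV[R]_n.+2 @^-1` @unit_sphere R n.+2).
    by rewrite -[X in measurable X]setTI; apply: measurable_snd => //; exact: measurable_unit_sphere.
  exact: (measurableI _ _ mD1 mD2).
- by move=> [g u] [/= g1 u1]; exact: orthogonal_corner_mx.
- move=> Q oQ B mB.
  pose X t : 'cV[R]_(1 + n.+2) := cons_col (Gamma11 t, Num.sqrt (1 - Gamma11 t ^+ 2) *: U1 t).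
  have mX : measurable_fun setT X.
    apply: (measurableT_comp (@measurable_cons_col R n.+2)).
    apply: measurable_fun_pair; first exact: measurable_funP.
    apply: measurable_scalemx; last exact: measurable_funP.
    apply: measurableT_comp; first exact: measurable_sqrtr.
    by apply: measurable_funB => //; apply: measurable_funX; exact: measurable_funP.
  have XE t : E1 t -> M (w t) *m delta_mx 0 0 = X t.
    by move=> [/= g1 _]; rewrite /M/= corner_mx_delta.
  have mQ : measurable [set z : 'cV[R]_(1 + n.+2) | B (Q *m z)].
    rewrite -[X in measurable X]setTI; apply: (_ : measurable_fun setT
      (fun z : 'cV[R]_(1 + n.+2) => Q *m z)) => //.
    by apply: measurable_mulmx => //; exact: measurable_cst.
  have full (A : set 'cV[R]_(1 + n.+2)) : measurable A ->
      P [set t | A (M (w t) *m delta_mx 0 0)] = P [set t | A (X t)].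
    move=> mA; apply: (probability_eq_full mE1) => //; last by move=> t Et /=; rewrite XE.
      rewrite -[X in measurable X]setTI; apply: (_ : measurable_fun setT
        (fun t => M (w t) *m delta_mx 0 0)) => //.
      apply: measurable_mulmx; last exact: measurable_cst.
      exact: (measurableT_comp mM mW).
    by rewrite -[X in measurable X]setTI; exact: mX.
  rewrite (full _ mQ) (full _ mB).
  rewrite (first_column_integral indep Gamma11_density U1_unif Psi_haar mQ).
  rewrite (first_column_integral indep Gamma11_density U1_unif Psi_haar mB).
  have [la laL] := exists_lebesgue R n.+2.
  by rewrite (first_column_law laL Psi_haar oQ mB).
- exact: measurableI.
- by apply: probability_setI1 => //; exact: U2_unif.1.
- move=> t [[/= g1 _] u2]; rewrite Gamma_factor// PsiE; congr (_ *m _).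
Qed.
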